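(* Consider, on every element of the mesh, the semi-discrete scheme (ESDGSEM) for the two-dimensional shallow water equations on curvilinear grids, $$\mathbf J\circ(\mathbf W_k)_t+\mathbf P_k+\mathbf R_k=\mathbf S\left(\tilde{\mathbf F}_k^{*,es}-\tilde{\mathbf F}_k\right)+\left(\tilde{\mathbf G}_k^{*,es}-\tilde{\mathbf G}_k\right)\mathbf S+\mathbf{source}_k,\qquad k=1,2,3,$$ with the following ingredients (notation as in the context). (Volume terms) The flux-differencing arrays $\mathbf P_k,\mathbf R_k$ have entries, for $i,j=0,\dots,N$, $$P_k^{i,j}=\frac1{\omega_i}\sum_{m=0}^N2Q_{im}\Big(F_k^{vol}(\vec W^{i,j},\vec W^{m,j})\,\tfrac{y_\eta^{i,j}+y_\eta^{m,j}}2-G_k^{vol}(\vec W^{i,j},\vec W^{m,j})\,\tfrac{x_\eta^{i,j}+x_\eta^{m,j}}2\Big),$$ $$R_k^{i,j}=\frac1{\omega_j}\sum_{m=0}^N2Q_{jm}\Big(-F_k^{vol}(\vec W^{i,j},\vec W^{i,m})\,\tfrac{y_\xi^{i,j}+y_\xi^{i,m}}2+G_k^{vol}(\vec W^{i,j},\vec W^{i,m})\,\tfrac{x_\xi^{i,j}+x_\xi^{i,m}}2\Big),$$ where, with $\{\!\{\cdot\}\!\}$ the arithmetic mean over the two argument states, $$\vec F^{vol}=\begin{pmatrix}\{\!\{hu\}\!\}\\ \{\!\{hu\}\!\}\{\!\{u\}\!\}+g\{\!\{h\}\!\}^2-\tfrac12g\{\!\{h^2\}\!\}\\ \{\!\{hu\}\!\}\{\!\{v\}\!\}\end{pmatrix},\qquad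 \vec G^{vol}=\begin{pmatrix}\{\!\{hv\}\!\}\\ \{\!\{hv\}\!\}\{\!\{u\}\!\}\\ \{\!\{hv\}\!\}\{\!\{v\}\!\}+g\{\!\{h\}\!\}^2-\tfrac12g\{\!\{h^2\}\!\}\end{pmatrix}.$$ (Surface fluxes) $\tilde{\mathbf F}_k^{*,es}$ and $\tilde{\mathbf G}_k^{*,es}$ are the contravariant numerical fluxes built from the entropy stable fluxes $$\vec F^{*,es}=\vec F^{*,ec}-\tfrac12\mathbf R_f|\mathbf\Lambda_f|\mathbf Z\mathbf R_f^T[\![\vec q\,]\!],\qquad \vec G^{*,es}=\vec G^{*,ec}-\tfrac12\mathbf R_g|\mathbf\Lambda_g|\mathbf Z\mathbf R_g^T[\![\vec q\,]\!],$$ $$\vec F^{*,ec}=\begin{pmatrix}\{\!\{h\}\!\}\{\!\{u\}\!\}\\ \{\!\{h\}\!\}\{\!\{u\}\!\}^2+\tfrac12g\{\!\{h^2\}\!\}\\ \{\!\{h\}\!\}\{\!\{u\}\!\}\{\!\{v\}\!\}\end{pmatrix},\qquad \vec G^{*,ec}=\begin{pmatrix}\{\!\{h\}\!\}\{\!\{v\}\!\}\\ \{\!\{h\}\!\}\{\!\{u\}\!\}\{\!\{v\}\!\}\\ \{\!\{h\}\!\}\{\!\{v\}\!\}^2+\tfrac12g\{\!\{h^2\}\!\}\end{pmatrix},$$ where $\{\!\{\cdot\}\!\}$ is the mean of the two neighbouring states at the interface, and $$\mathbf R_f=\begin{pmatrix} 1 & 0 & 1 \\ u+c & 0 & u-c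 \\ v & 1 & v \end{pmatrix},\quad\mathbf R_g=\begin{pmatrix} 1 & 0 & 1 \\ u & 1 & u \\ v+c & 0 & v-c \end{pmatrix},\quad\mathbf Z=\mathrm{diag}\Big(\frac1{2g},h,\frac1{2g}\Big),$$ $\mathbf\Lambda_f=\mathrm{diag}(u+c,u,u-c)$, $\mathbf\Lambda_g=\mathrm{diag}(v+c,v,v-c)$, $c=\sqrt{gh}$, all computed from the arithmetic average values at the element interface. (Source term) $\mathbf{source}_1=\mathbf 0$, $$\mathbf{source}_2=-\tfrac g2\mathbf h\circ\big[\mathbf y_\eta\circ\mathbf D\mathbf b+\mathbf D(\mathbf y_\eta\circ\mathbf b)-\mathbf y_\xi\circ(\mathbf b\mathbf D^T)-(\mathbf y_\xi\circ\mathbf b)\mathbf D^T\big]-\tfrac g2\mathbf M^{-1}\big(\mathbf y_\eta\circ\{\!\{\mathbf h\}\!\}_\xi\circ[\![\mathbf b]\!]_\xi\big)+\tfrac g2\big(\mathbf y_\xi\circ\{\!\{\mathbf h\}\!\}_\eta\circ[\![\mathbf b]\!]_\eta\big)\mathbf M^{-1},$$ $$\mathbf{source}_3=-\tfrac g2\mathbf h\circ\big[-\mathbf x_\eta\circ\mathbf D\mathbf b-\mathbf D(\mathbf x_\eta\circ\mathbf b)+\mathbf x_\xi\circ(\mathbf b\mathbf D^T)+(\mathbf x_\xi\circ\mathbf b)\mathbf D^T\big]+\tfrac g2\mathbf M^{-1}\big(\mathbf x_\eta\circ\{\!\{\mathbf h\}\!\}_\xi\circ[\![\mathbf b]\!]_\xi\big)-\tfrac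 g2\big(\mathbf x_\xi\circ\{\!\{\mathbf h\}\!\}_\eta\circ[\![\mathbf b]\!]_\eta\big)\mathbf M^{-1}.$$ Then the scheme has the following properties: 1. Discrete conservation of the mass, and discrete conservation of the momentum if the bottom topography is constant. 2. Discrete entropy stability. 3. The well-balanced property for arbitrary bottom topographies.
   Context: Shallow water equations: $h_t+(hu)_x+(hv)_y=0$, $(hu)_t+(hu^2+gh^2/2)_x+(huv)_y=-ghb_x$, $(hv)_t+(huv)_x+(hv^2+gh^2/2)_y=-ghb_y$, where $g$ is the constant gravitational acceleration, $h$ is the water height, $(u,v)$ the velocity and $b=b(x,y)$ the bottom topography. Conserved variables $\vec w=(h,hu,hv)^T$; physical fluxes $\vec f=(hu,hu^2+gh^2/2,huv)^T$, $\vec g=(hv,huv,hv^2+gh^2/2)^T$. Entropy function (total energy): $e=\tfrac12h(u^2+v^2)+\tfrac12gh^2+ghb$. Entropy fluxes: $\mathcal F=\tfrac12(hu^3+huv^2)+ghu(h+b)$, $\mathcal G=\tfrac12(hv^3+hu^2v)+ghv(h+b)$. Entropy variables: $\vec q=\partial e/\partial\vec w=\big(g(h+b)-\tfrac12u^2-\tfrac12v^2,\;u,\;v\big)^T$. Operators. Let $N$ be the polynomial degree, $\xi_0=-1<\dots<\xi_N=1$ the Legendre-Gauss-Lobatto nodes on $[-1,1]$ with quadrature weights $\omega_0,\dots,\omega_N$, and $\ell_j$ the associated Lagrange polynomials. Set $D_{ij}=\ell_j'(\xi_i)$, $\mathbf M=\mathrm{diag}(\omega_0,\dots,\omega_N)$,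 $\mathbf Q=\mathbf M\mathbf D$, $\mathbf S=\mathrm{diag}(1/\omega_0,0,\dots,0,-1/\omega_N)$. The summation-by-parts property $\mathbf Q+\mathbf Q^T=\mathrm{diag}(-1,0,\dots,0,1)$ holds. Nodal arrays. On each element a quantity is represented by the $(N+1)\times(N+1)$ array of its values at the nodes $(\xi_i,\eta_j)$, $\eta_j=\xi_j$, with row index $i$ ($\xi$-direction) and column index $j$ ($\eta$-direction). So $\mathbf D\mathbf A$ and $\mathbf A\mathbf D^T$ are the discrete $\xi$- and $\eta$-derivatives; $\circ$ is the entrywise (Hadamard) product. $\mathbf W_k$ is the array of the time-dependent nodal values $W_k^{i,j}$ of the $k$-th conserved variable and $\vec W^{i,j}=(W_1^{i,j},W_2^{i,j},W_3^{i,j})$; nodal velocities are $u^{i,j}=W_2^{i,j}/W_1^{i,j}$, $v^{i,j}=W_3^{i,j}/W_1^{i,j}$. The arrays $\mathbf h,\mathbf b$ contain the nodal values of $h$ and $b$; $b$ may be discontinuous across element interfaces. Mesh and metric terms. The domain is divided into non-overlapping, possibly curved, quadrilateral elements; each is the image of $[-1,1]^2$ under a map $(x(\xi,\eta),y(\xi,\eta))$ given by transfinite interpolation with linear blending of boundary curves that are polynomials of degree at most $N$. $\mathbf x_\xi,\mathbf x_\eta,\mathbf y_\xi,\mathbf y_\eta$ are the nodal arrays of the derivatives of this map, and $\mathbf J$ has entries $J^{i,j}=x_\xi y_\eta-x_\eta y_\xi$. The discrete metric identities $\mathbf D\mathbf y_\eta-\mathbf y_\xi\mathbf D^T=\mathbf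 0$ and $-\mathbf D\mathbf x_\eta+\mathbf x_\xi\mathbf D^T=\mathbf 0$ hold. Interface quantities. At a node of an element side, the ''inner'' value is that of the element itself and the ''outer'' value is that of the neighbouring element. Averages at interfaces are arithmetic means of inner and outer value. Local jumps $[\![\cdot]\!]$ of any nodal quantity are oriented by the $\xi$ and $\eta$ coordinate directions: inner minus outer at the sides $\xi=-1$ and $\eta=-1$, outer minus inner at the sides $\xi=1$ and $\eta=1$. $\{\!\{\mathbf h\}\!\}_\xi$ and $[\![\mathbf b]\!]_\xi$ are the arrays whose only nonzero rows are $i=0$ and $i=N$, containing the averages of $h$ and jumps of $b$ at the sides $\xi=-1$ and $\xi=1$; $\{\!\{\mathbf h\}\!\}_\eta$ and $[\![\mathbf b]\!]_\eta$ are the arrays whose only nonzero columns are $j=0$ and $j=N$, containing those at the sides $\eta=-1$ and $\eta=1$. Contravariant fluxes. $\tilde F_k^{i,j}=y_\eta^{i,j}f_k(\vec W^{i,j})-x_\eta^{i,j}g_k(\vec W^{i,j})$ and $\tilde G_k^{i,j}=-y_\xi^{i,j}f_k(\vec W^{i,j})+x_\xi^{i,j}g_k(\vec W^{i,j})$. Given numerical fluxes $\vec F^*,\vec G^*$ at interface nodes, $\tilde{\mathbf F}_k^*$ has entries $y_\eta F_k^*-x_\eta G_k^*$ in rows $i=0,N$ (the sides $\xi=\mp1$) and zeros elsewhere; $\tilde{\mathbf G}_k^*$ has entries $-y_\xi F_k^*+x_\xi G_k^*$ in columns $j=0,N$ (the sides $\eta=\mp1$) and zeros elsewhere. Terminology.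 Discrete conservation of component $k$ ($k=1$: mass; $k=2,3$: momentum) means that on each element the quadrature total of $W_k$ changes only through the numerical fluxes at the element boundary: $$\sum_{i,j=0}^N\omega_i\omega_jJ^{i,j}(W_k^{i,j})_t=-\sum_{j=0}^N\omega_j\big[(\tilde F_k^* )^{N,j}-(\tilde F_k^* )^{0,j}\big]-\sum_{i=0}^N\omega_i\big[(\tilde G_k^* )^{i,N}-(\tilde G_k^* )^{i,0}\big].$$ An approximation is (discretely) entropy stable if it discretely satisfies the entropy inequality $e_t+\mathcal F_x+\mathcal G_y\le0$. Well-balanced means that the ''lake at rest'' state $h+b=\mathrm{const}$, $u=v=0$ is preserved for all time, i.e. for such nodal data the discrete time derivatives $(\mathbf W_k)_t$ vanish.
   Formalization: In entropy stability, the jump of q in the dissipation of F* and G* is oriented by increasing x and y (by the signs of the metric terms at the sides), not by ξ and η: with the latter the claim fails, e.g. for x = −ξ, y = −η. Conservation and well-balancedness hold for every orientation. *)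

(* Defs.v *)
From HB Require Import structures.
From mathcomp Require Export all_boot all_order all_algebra.
From mathcomp Require Export all_classical all_reals all_analysis.
Set Implicit Arguments.
Unset Strict Implicit.
Unset Printing Implicit Defensive.
Import Order.TTheory GRing.Theory Num.Theory.
Local Open Scope ring_scope.

Section Generalities.
Context {R : realType}.

Definition mean (x y : R) : R := (x + y) / 2.

Definition col3 (a b c : R) : 'cV[R]_3 := \col_(k < 3) [:: a; b; c]`_k.

Definition mat3 (r0 r1 r2 : seq R) : 'M[R]_3 :=
  \matrix_(k < 3, l < 3) (nth [::] [:: r0; r1; r2] k)`_l.

Definition hadamard m n (A B : 'M[R]_(m, n)) : 'M[R]_(m, n) := map2_mx *%R A B.

End Generalities.

Notation "A ⊙ B" := (hadamard A B) (at level 40, left associativity) : ring_scope.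

(* Components k = 1, 2, 3 of the system are the ordinals 0, 1, 2. *)
Definition k1 : 'I_3 := @Ordinal 3 0 isT.
Definition k2 : 'I_3 := @Ordinal 3 1 isT.
Definition k3 : 'I_3 := @Ordinal 3 2 isT.

Section LegendreGaussLobatto.
Context {R : realType}.

(* Bonnet recurrence; [legendre_pair n] is the pair (L_n, L_(n+1)). *)
Fixpoint legendre_pair (n : nat) : {poly R} * {poly R} :=
  if n is m.+1 then
    let: (p, q) := legendre_pair m in
    (q, (m.+2)%:R^-1 *: ((m.*2.+3)%:R *: ('X * q) - (m.+1)%:R *: p))
  else (1, 'X).

Definition legendre (n : nat) : {poly R} := (legendre_pair n).1.

Variable N : nat.
Implicit Types (xi w : 'I_N.+1 -> R).

Definition lagrange_poly xi (j : 'I_N.+1) : {poly R} :=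
  \prod_(m < N.+1 | m != j) ((xi j - xi m)^-1 *: ('X - (xi m)%:P)).

Record is_LGL xi w : Prop := IsLGL {
  LGL_first : xi ord0 = -1;
  LGL_last : xi ord_max = 1;
  LGL_incr : forall i j : 'I_N.+1, (i < j)%N -> xi i < xi j;
  LGL_inner : forall i : 'I_N.+1, (0 < i < N)%N ->
    root (deriv (legendre N)) (xi i);
  LGL_weight : forall j : 'I_N.+1,
    w j = Rintegral lebesgue_measure `[(-1 : R), (1 : R)]%classic
            (fun x => (lagrange_poly xi j).[x]) }.

Definition matD xi : 'M[R]_N.+1 :=
  \matrix_(i, j) (deriv (lagrange_poly xi j)).[xi i].
Definition matM w : 'M[R]_N.+1 := diag_mx (\row_i w i).
Definition matMinv w : 'M[R]_N.+1 := diag_mx (\row_i (w i)^-1).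
Definition matQ xi w : 'M[R]_N.+1 := matM w *m matD xi.
Definition matB : 'M[R]_N.+1 := delta_mx ord_max ord_max - delta_mx ord0 ord0.
Definition matS w : 'M[R]_N.+1 :=
  (w ord0)^-1 *: delta_mx ord0 ord0 - (w ord_max)^-1 *: delta_mx ord_max ord_max.

Definition SBP xi w : Prop := matQ xi w + (matQ xi w)^T = matB.

End LegendreGaussLobatto.
Arguments legendre {R} n.

Section ShallowWater.
Context {R : realType}.
Variable g : R.

Implicit Types (a : 'cV[R]_3).

Definition hgt a : R := a k1 0.
Definition mom_x a : R := a k2 0.
Definition mom_y a : R := a k3 0.
Definition vel_u a : R := mom_x a / hgt a.
Definition vel_v a : R := mom_y a / hgt a.

Definition flux_f a : 'cV[R]_3 :=
  let: (h, u, v) := (hgt a, vel_u a, vel_v a) in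
  col3 (h * u) (h * u ^+ 2 + g * h ^+ 2 / 2) (h * u * v).
Definition flux_g a : 'cV[R]_3 :=
  let: (h, u, v) := (hgt a, vel_u a, vel_v a) in
  col3 (h * v) (h * u * v) (h * v ^+ 2 + g * h ^+ 2 / 2).

Definition avg (phi : 'cV[R]_3 -> R) a a' : R := mean (phi a) (phi a').

Definition Fvol a a' : 'cV[R]_3 :=
  let pressure := g * avg hgt a a' ^+ 2 - g / 2 * avg (fun y => hgt y ^+ 2) a a' in
  col3 (avg mom_x a a')
       (avg mom_x a a' * avg vel_u a a' + pressure)
       (avg mom_x a a' * avg vel_v a a').
Definition Gvol a a' : 'cV[R]_3 :=
  let pressure := g * avg hgt a a' ^+ 2 - g / 2 * avg (fun y => hgt y ^+ 2) a a' in
  col3 (avg mom_y a a')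
       (avg mom_y a a' * avg vel_u a a')
       (avg mom_y a a' * avg vel_v a a' + pressure).

(* Conserved variables and bottom elevation at a point. *)
Definition trace : Type := 'cV[R]_3 * R.
Implicit Types (z l r : trace).

Definition entropy z : R :=
  let: (h, u, v, b) := (hgt z.1, vel_u z.1, vel_v z.1, z.2) in
  1 / 2 * h * (u ^+ 2 + v ^+ 2) + 1 / 2 * g * h ^+ 2 + g * h * b.
Definition entropy_flux_F z : R :=
  let: (h, u, v, b) := (hgt z.1, vel_u z.1, vel_v z.1, z.2) in
  1 / 2 * (h * u ^+ 3 + h * u * v ^+ 2) + g * h * u * (h + b).
Definition entropy_flux_G z : R :=
  let: (h, u, v, b) := (hgt z.1, vel_u z.1, vel_v z.1, z.2) in
  1 / 2 * (h * v ^+ 3 + h * u ^+ 2 * v) + g * h * v * (h + b).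
Definition entropy_vars z : 'cV[R]_3 :=
  let: (h, u, v, b) := (hgt z.1, vel_u z.1, vel_v z.1, z.2) in
  col3 (g * (h + b) - u ^+ 2 / 2 - v ^+ 2 / 2) u v.

Definition Fec a a' : 'cV[R]_3 :=
  let: (h, u, v) := (avg hgt a a', avg vel_u a a', avg vel_v a a') in
  let pressure := 1 / 2 * g * avg (fun y => hgt y ^+ 2) a a' in
  col3 (h * u) (h * u ^+ 2 + pressure) (h * u * v).
Definition Gec a a' : 'cV[R]_3 :=
  let: (h, u, v) := (avg hgt a a', avg vel_u a a', avg vel_v a a') in
  let pressure := 1 / 2 * g * avg (fun y => hgt y ^+ 2) a a' in
  col3 (h * v) (h * u * v) (h * v ^+ 2 + pressure).

Definition matRf (u v c : R) : 'M[R]_3 :=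
  mat3 [:: 1; 0; 1] [:: u + c; 0; u - c] [:: v; 1; v].
Definition matRg (u v c : R) : 'M[R]_3 :=
  mat3 [:: 1; 0; 1] [:: u; 1; u] [:: v + c; 0; v - c].
Definition absLambda (s c : R) : 'M[R]_3 :=
  diag_mx (col3 `|s + c| `|s| `|s - c|)^T.
Definition matZ (h : R) : 'M[R]_3 :=
  diag_mx (col3 (1 / (2 * g)) h (1 / (2 * g)))^T.

(* Numerical fluxes as functions of an ordered pair (l, r) of traces; the jump
   of the entropy variables is r minus l. *)
Definition Fes l r : 'cV[R]_3 :=
  let: (h, u, v) := (avg hgt l.1 r.1, avg vel_u l.1 r.1, avg vel_v l.1 r.1) in
  let c := Num.sqrt (g * h) in
  Fec l.1 r.1 - (1 / 2) *:
    (matRf u v c *m absLambda u c *m matZ h *m (matRf u v c)^T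
       *m (entropy_vars r - entropy_vars l)).
Definition Ges l r : 'cV[R]_3 :=
  let: (h, u, v) := (avg hgt l.1 r.1, avg vel_u l.1 r.1, avg vel_v l.1 r.1) in
  let c := Num.sqrt (g * h) in
  Gec l.1 r.1 - (1 / 2) *:
    (matRg u v c *m absLambda v c *m matZ h *m (matRg u v c)^T
       *m (entropy_vars r - entropy_vars l)).

End ShallowWater.

(* [(false, p)] is the side xi = 1 if [p] and xi = -1 otherwise;
   [(true, p)] is the side eta = 1 if [p] and eta = -1 otherwise. *)
Definition side : Type := (bool * bool)%type.
Definition west : side := (false, false).
Definition east : side := (false, true).
Definition south : side := (true, false).
Definition north : side := (true, true).

(* Is the increasing direction of the side's own parameter (eta on west and
   east, xi on south and north) the counterclockwise one? *)
Definition ccw (s : side) : bool := s.1 != s.2.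

Section Mesh.
Context {R : realType} {N : nat}.
Variable xi : 'I_N.+1 -> R.

(* Transfinite interpolation with linear blending of four boundary curves
   (one coordinate), each parametrised by the free variable of its side. *)
Definition transfinite (c : side -> {poly R}) (s t : R) : R :=
  ((1 - s) * (c west).[t] + (1 + s) * (c east).[t]
   + (1 - t) * (c south).[s] + (1 + t) * (c north).[s]) / 2
  - ((1 - s) * ((1 - t) * (c south).[-1] + (1 + t) * (c north).[-1])
     + (1 + s) * ((1 - t) * (c south).[1] + (1 + t) * (c north).[1])) / 4.

Definition d_xi (c : side -> {poly R}) : 'M[R]_N.+1 :=
  \matrix_(i, j) derive1 (fun s : R => transfinite c s (xi j)) (xi i).
Definition d_eta (c : side -> {poly R}) : 'M[R]_N.+1 :=
  \matrix_(i, j) derive1 (fun t : R => transfinite c (xi i) t) (xi j).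

(* [nbr K s] is the neighbouring element across side [s] of [K] together with
   the corresponding side of that element, or [None] on the domain boundary. *)
Record mesh (T : finType) := Mesh {
  mx : T -> side -> {poly R};
  my : T -> side -> {poly R};
  nbr : T -> side -> option (T * side) }.

Variables (T : finType) (m : mesh T).
Implicit Types (K : T) (s : side).

Definition x_xi K := d_xi (mx m K).
Definition x_eta K := d_eta (mx m K).
Definition y_xi K := d_xi (my m K).
Definition y_eta K := d_eta (my m K).
Definition jac K : 'M[R]_N.+1 := x_xi K ⊙ y_eta K - x_eta K ⊙ y_xi K.

Definition closed_boundary (c : side -> {poly R}) : Prop :=
  [/\ (c south).[-1] = (c west).[-1], (c south).[1] = (c east).[-1],
      (c north).[1] = (c east).[1] & (c north).[-1] = (c west).[1]].

(* The curves of two glued sides coincide, up to a translation so as to allow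
   periodic identifications, and have opposite counterclockwise orientations. *)
Definition glued (s s' : side) (p p' : {poly R}) : Prop :=
  exists d : R, p' = (if ccw s == ccw s' then p \Po (- 'X) else p) + d%:P.

Definition in_square (s t : R) : bool := (-1 < s < 1) && (-1 < t < 1).

Record is_mesh : Prop := IsMesh {
  mesh_degree : forall K s,
    (size (mx m K s) <= N.+1)%N /\ (size (my m K s) <= N.+1)%N;
  mesh_corner : forall K, closed_boundary (mx m K) /\ closed_boundary (my m K);
  mesh_jac : forall K i j, 0 < jac K i j;
  mesh_disjoint : forall K K' (s t s' t' : R),
    in_square s t -> in_square s' t' ->
    transfinite (mx m K) s t = transfinite (mx m K') s' t' ->
    transfinite (my m K) s t = transfinite (my m K') s' t' ->
    [/\ K = K', s = s' & t = t'];
  mesh_nbr : forall K s K' s', nbr m K s = Some (K', s') ->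
    [/\ nbr m K' s' = Some (K, s),
        glued s s' (mx m K s) (mx m K' s')
      & glued s s' (my m K s) (my m K' s')] }.

Definition metric_identities : Prop := forall K,
  matD xi *m y_eta K - y_xi K *m (matD xi)^T = 0 /\
  - (matD xi *m x_eta K) + x_xi K *m (matD xi)^T = 0.

Definition side_node s (r : 'I_N.+1) : 'I_N.+1 * 'I_N.+1 :=
  let e := if s.2 then ord_max else ord0 in if s.1 then (r, e) else (e, r).

(* Node of side [s'] that coincides with node [r] of the glued side [s]. *)
Definition match_node s s' (r : 'I_N.+1) : 'I_N.+1 :=
  if ccw s == ccw s' then rev_ord r else r.

(* Scaled normal pointing in the direction of increasing xi (west, east) or
   increasing eta (south, north): the coefficients of F and G in the
   contravariant flux through side [s]. *)
Definition conormal K s (r : 'I_N.+1) : R * R :=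
  let: (i, j) := side_node s r in
  if s.1 then (- y_xi K i j, x_xi K i j) else (y_eta K i j, - x_eta K i j).

Definition outward s (x : R) : R := if s.2 then x else - x.

(* An orientation tells, at every interface node, whether the pair of states
   fed to a numerical flux, hence the jump in its dissipation term, is ordered
   along the increasing local coordinate, xi or eta ([true]), or against it
   ([false]). *)
Definition orientation : Type := T -> side -> 'I_N.+1 -> bool.

(* [oF] and [oG] order the two states by increasing x and by increasing y,
   respectively (no constraint where the conormal component vanishes).  This
   makes the two elements at an interface use the same x- and y-fluxes, and the
   dissipation enter with the right sign; the local order [true] has both
   properties only where the conormal components are nonnegative. *)
Definition cartesian_orientation (oF oG : orientation) : Prop :=
  forall K s r,
    (if oF K s r then 0 <= (conormal K s r).1 else (conormal K s r).1 <= 0) /\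
    (if oG K s r then 0 <= (conormal K s r).2 else (conormal K s r).2 <= 0).

Lemma cartesian_orientation_exists :
  exists oF oG : orientation, cartesian_orientation oF oG.
Proof.
exists (fun K s r => 0 <= (conormal K s r).1).
exists (fun K s r => 0 <= (conormal K s r).2).
move=> K s r; split; case: ifPn => // /negbTE; rewrite leNgt => /negbFE;
  exact: ltW.
Qed.

End Mesh.

Section Scheme.
Context {R : realType} {N : nat}.
Variables (xi w : 'I_N.+1 -> R) (g : R) (T : finType) (m : @mesh R T).
Variables (oF oG : @orientation N T).

Local Notation matrixN := 'M[R]_N.+1.

(* Nodal arrays of the conserved variables; [ext] gives the outer traces on the
   domain boundary, where there is no neighbouring element. *)
Definition nodal_data : Type := T -> 'I_3 -> matrixN.
Definition boundary_data : Type := T -> side -> 'I_N.+1 -> @trace R.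

Definition state (U : nodal_data) (K : T) (i j : 'I_N.+1) : 'cV[R]_3 :=
  \col_k U K k i j.

Section Snapshot.
Variables (U : nodal_data) (b : T -> matrixN) (ext : boundary_data).
Implicit Types (K : T) (s : side).

Definition inner K s r : @trace R :=
  let: (i, j) := side_node s r in (state U K i j, b K i j).
Definition outer K s r : @trace R :=
  if nbr m K s is Some (K', s') then inner K' s' (match_node s s' r)
  else ext K s r.

(* The two traces in the order of the increasing local coordinate, so that a
   local jump is the second minus the first. *)
Definition local_pair K s r : @trace R * @trace R :=
  if s.2 then (inner K s r, outer K s r) else (outer K s r, inner K s r).

Definition flux_pair (o : orientation T) K s r : @trace R * @trace R :=
  let: (l, r') := local_pair K s r in if o K s r then (l, r') else (r', l).

Definition Fstar K s r : 'cV[R]_3 :=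
  Fes g (flux_pair oF K s r).1 (flux_pair oF K s r).2.
Definition Gstar K s r : 'cV[R]_3 :=
  Ges g (flux_pair oG K s r).1 (flux_pair oG K s r).2.

Definition avg_h K s r : R :=
  mean (hgt (inner K s r).1) (hgt (outer K s r).1).
Definition jump_b K s r : R :=
  (local_pair K s r).2.2 - (local_pair K s r).1.2.

Definition xi_rows (phi : side -> 'I_N.+1 -> R) : matrixN :=
  \matrix_(i, j) (if i == ord0 then phi west j
                  else if i == ord_max then phi east j else 0).
Definition eta_cols (phi : side -> 'I_N.+1 -> R) : matrixN :=
  \matrix_(i, j) (if j == ord0 then phi south i
                  else if j == ord_max then phi north i else 0).

Definition Ftilde K k : matrixN := \matrix_(i, j)
  (y_eta xi m K i j * flux_f g (state U K i j) k 0
   - x_eta xi m K i j * flux_g g (state U K i j) k 0).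
Definition Gtilde K k : matrixN := \matrix_(i, j)
  (- y_xi xi m K i j * flux_f g (state U K i j) k 0
   + x_xi xi m K i j * flux_g g (state U K i j) k 0).

Definition Fstar_tilde K k : matrixN :=
  y_eta xi m K ⊙ xi_rows (fun s r => Fstar K s r k 0)
  - x_eta xi m K ⊙ xi_rows (fun s r => Gstar K s r k 0).
Definition Gstar_tilde K k : matrixN :=
  - (y_xi xi m K ⊙ eta_cols (fun s r => Fstar K s r k 0))
  + x_xi xi m K ⊙ eta_cols (fun s r => Gstar K s r k 0).

Definition volP K k : matrixN := \matrix_(i, j)
  ((w i)^-1 * \sum_(n < N.+1) 2 * matQ xi w i n *
     (Fvol g (state U K i j) (state U K n j) k 0
        * mean (y_eta xi m K i j) (y_eta xi m K n j)
      - Gvol g (state U K i j) (state U K n j) k 0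
        * mean (x_eta xi m K i j) (x_eta xi m K n j))).
Definition volR K k : matrixN := \matrix_(i, j)
  ((w j)^-1 * \sum_(n < N.+1) 2 * matQ xi w j n *
     (- Fvol g (state U K i j) (state U K i n) k 0
        * mean (y_xi xi m K i j) (y_xi xi m K i n)
      + Gvol g (state U K i j) (state U K i n) k 0
        * mean (x_xi xi m K i j) (x_xi xi m K i n))).

Definition source2 K : matrixN :=
  let: (ye, yx, D) := (y_eta xi m K, y_xi xi m K, matD xi) in
  - (g / 2) *: (U K k1 ⊙ (ye ⊙ (D *m b K) + D *m (ye ⊙ b K)
                          - yx ⊙ (b K *m D^T) - (yx ⊙ b K) *m D^T))
  - (g / 2) *: (matMinv w *m (ye ⊙ xi_rows (avg_h K) ⊙ xi_rows (jump_b K)))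
  + (g / 2) *: ((yx ⊙ eta_cols (avg_h K) ⊙ eta_cols (jump_b K)) *m matMinv w).
Definition source3 K : matrixN :=
  let: (xe, xx, D) := (x_eta xi m K, x_xi xi m K, matD xi) in
  - (g / 2) *: (U K k1 ⊙ (- (xe ⊙ (D *m b K)) - D *m (xe ⊙ b K)
                          + xx ⊙ (b K *m D^T) + (xx ⊙ b K) *m D^T))
  + (g / 2) *: (matMinv w *m (xe ⊙ xi_rows (avg_h K) ⊙ xi_rows (jump_b K)))
  - (g / 2) *: ((xx ⊙ eta_cols (avg_h K) ⊙ eta_cols (jump_b K)) *m matMinv w).
Definition source K (k : 'I_3) : matrixN :=
  if k == k1 then 0 else if k == k2 then source2 K else source3 K.

Definition ESDGSEM (Ut : nodal_data) : Prop := forall K k,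
  jac xi m K ⊙ Ut K k + volP K k + volR K k =
    matS w *m (Fstar_tilde K k - Ftilde K k)
    + (Gstar_tilde K k - Gtilde K k) *m matS w + source K k.

Definition forall_traces (P : @trace R -> Prop) : Prop :=
  (forall K i j, P (state U K i j, b K i j)) /\
  (forall K s r, nbr m K s = None -> P (ext K s r)).

Definition positive_height : Prop := forall_traces (fun z => 0 < hgt z.1).

Definition constant_bottom : Prop :=
  exists c : R, forall_traces (fun z => z.2 = c).

Definition lake_at_rest : Prop := exists c : R, forall_traces
  (fun z => [/\ hgt z.1 + z.2 = c, vel_u z.1 = 0 & vel_v z.1 = 0]).

Definition conserves (Ut : nodal_data) (k : 'I_3) : Prop := forall K,
  \sum_(i < N.+1) \sum_(j < N.+1) w i * w j * jac xi m K i j * Ut K k i j =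
    - \sum_(j < N.+1) w j * (Fstar_tilde K k ord_max j - Fstar_tilde K k ord0 j)
    - \sum_(i < N.+1) w i * (Gstar_tilde K k i ord_max - Gstar_tilde K k i ord0).

(* Side [s] of [K] belongs to the boundary of the union of the elements of [A]. *)
Definition exposed (A : {set T}) K s : bool :=
  if nbr m K s is Some (K', _) then K' \notin A else true.

(* Outward flux at a side node for numerical entropy fluxes [HF], [HG]. *)
Definition entropy_outflow (HF HG : @trace R -> @trace R -> R) K s r : R :=
  outward s ((conormal xi m K s r).1
               * HF (flux_pair oF K s r).1 (flux_pair oF K s r).2
             + (conormal xi m K s r).2
               * HG (flux_pair oG K s r).1 (flux_pair oG K s r).2).

(* Discrete entropy inequality on the union of the elements of [A]; [et]
   stands for the nodal values of the time derivative of the entropy. *)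
Definition entropy_inequality (HF HG : @trace R -> @trace R -> R)
    (et : T -> matrixN) (A : {set T}) : Prop :=
  \sum_(K in A) \sum_(i < N.+1) \sum_(j < N.+1)
     w i * w j * jac xi m K i j * et K i j
  + \sum_(K in A) \sum_(s : side | exposed A K s) \sum_(r < N.+1)
     w r * entropy_outflow HF HG K s r <= 0.

End Snapshot.

Variables (W : R -> nodal_data) (b : T -> matrixN) (ext : R -> boundary_data).

Definition W_t (t : R) : nodal_data := fun K k =>
  \matrix_(i, j) derive1 (fun s : R => W s K k i j) t.

Definition e_t (t : R) : T -> matrixN := fun K =>
  \matrix_(i, j) derive1 (fun s : R => entropy g (state (W s) K i j, b K i j)) t.

Definition solves_ESDGSEM (t : R) : Prop :=
  [/\ forall K k i j, derivable (fun s : R => W s K k i j) t 1,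
      positive_height (W t) b (ext t)
    & ESDGSEM (W t) b (ext t) (W_t t)].

End Scheme.

Definition consistent_entropy_fluxes (R : realType) (g : R)
    (HF HG : @trace R -> @trace R -> R) : Prop :=
  forall z : @trace R, 0 < hgt z.1 ->
    HF z z = entropy_flux_F g z /\ HG z z = entropy_flux_G g z.

(* Main.v *)
Require Import Defs.
From mathcomp Require Import all_boot all_order all_algebra.
From mathcomp Require Import all_classical all_reals all_analysis.
From mathcomp Require Import ring lra zify polyorder polyrcf.
Set Implicit Arguments.
Unset Strict Implicit.
Unset Printing Implicit Defensive.
Import Order.TTheory GRing.Theory Num.Theory.
Local Open Scope ring_scope.

(* Test the scheme against a nodal function q with values in R^3.
   Flux differencing with a symmetric two-point flux V turns summation by parts
   into a sum of (q_i - q_m) . V_im; if [[q]] . V = [[psi]] + c {{s}} [[b]] for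
   some potential psi, this sum telescopes up to the metric identities and a
   term c s D b.  With q constant, psi = 0 and c = 0 this gives conservation.
   With q the entropy variables, psi_f = g h^2 u / 2, s = hu and c = g (likewise
   in the y-direction), the term c s D b is cancelled by the volume source, and
   what remains sits on the element sides.
   Adding there the numerical entropy flux
     {{q}} . F - {{psi}} - g/4 {{h}} [[b]] [[u]]
   leaves minus a quarter of the quadratic form of R |Lambda| Z R^T at [[q]].
   The outward normals, hence the numerical entropy fluxes, of two glued sides
   are opposite, so interior sides cancel; this uses that the
   Legendre-Gauss-Lobatto nodes and weights are symmetric.  The weights are
   positive because summation by parts makes the quadrature exact up to degree
   2N - 1. *)

(** * Quadrature from summation by parts *)

(** The obstacle is the curved geometry: along a single grid line nothing telescopes completely,
    because the averaged metric factor leaves a remainder (psi + c s b / 2) times a derivative of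
    the metric term. It vanishes only once the xi- and eta-directions are added. The same averaging
    explains the split form of the source: differencing b with the factor {{y}} gives half of y D b
    plus half of D(y b). At the sides the source carries the inner velocity, whereas the entropy
    identity of the central flux carries {{u}}; they differ by [[u]]/2 up to sign, and the term g/4
    {{h}} [[b]] [[u]] of the numerical entropy flux makes up the difference. Well-balancedness is
    not a weak statement and is proved node by node. At rest the volume pressure g {{h}}^2 - g/2
    {{h^2}} equals g/2 h h', so flux differencing yields g h times the split derivative of h, and h
    = const - b turns this into the volume source; likewise the flux defect at a side is a pressure
    difference g/2 {{h}} [[h]], which matches the source jump. *)

Section Quadrature.
Context {R : realType} {N : nat}.
Variables (xi w : 'I_N.+1 -> R).
Hypothesis xi_inj : injective xi.

Lemma lagrange_node i j : (lagrange_poly xi j).[xi i] = (i == j)%:R.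
Proof.
rewrite /lagrange_poly horner_prod; case: eqVneq => [->|nij].
  rewrite big1 // => k nkj; rewrite !hornerE mulVf // subr_eq0.
  by apply: contra nkj => /eqP/xi_inj->.
by rewrite (bigD1 i) //= !hornerE subrr mulr0 mul0r.
Qed.

Lemma size_lagrange_poly j : (size (lagrange_poly xi j) <= N.+1)%N.
Proof.
rewrite /lagrange_poly; apply: leq_trans (size_poly_prod_leq _ _) _.
have cP : #|[pred m : 'I_N.+1 | m != j]| = N.
  by rewrite (cardC1 j) card_ord.
have : (\sum_(m < N.+1 | m != j)
   size ((xi j - xi m)^-1 *: ('X - (xi m)%:P))
   <= \sum_(m < N.+1 | m != j) 2)%N.
  apply: leq_sum => k _; apply: leq_trans (size_scale_leq _ _) _.
  by rewrite size_XsubC.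
rewrite sum_nat_const cP => h; rewrite leq_subLR.
by apply: leq_ltn_trans h _; lia.
Qed.

Lemma poly_eq_nodes (p q : {poly R}) :
  (size p <= N.+1)%N -> (size q <= N.+1)%N ->
  (forall i, p.[xi i] = q.[xi i]) -> p = q.
Proof.
move=> sp sq e; apply/eqP; rewrite -subr_eq0; apply/eqP.
apply: (@roots_geq_poly_eq0 _ _ [seq xi i | i <- enum 'I_N.+1]).
- by apply/allP => _ /mapP[i _ ->]; rewrite rootE !hornerE e subrr.
- by rewrite map_inj_uniq ?enum_uniq.
- rewrite size_map size_enum_ord; apply: leq_trans (size_polyD _ _) _.
  by rewrite size_polyN geq_max sp.
Qed.

Lemma lagrange_interpolation (p : {poly R}) : (size p <= N.+1)%N ->
  p = \sum_j p.[xi j] *: lagrange_poly xi j.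
Proof.
move=> sp; apply: poly_eq_nodes => // [|i].
  apply: leq_trans (size_sum _ _ _) _; apply/bigmax_leqP => j _.
  by apply: leq_trans (size_scale_leq _ _) (size_lagrange_poly j).
rewrite horner_sum (bigD1 i) //= big1 ?addr0.
  by rewrite hornerZ lagrange_node eqxx mulr1.
by move=> j /negbTE nji; rewrite hornerZ lagrange_node eq_sym nji mulr0.
Qed.

Lemma matD_horner (p : {poly R}) i : (size p <= N.+1)%N ->
  \sum_j matD xi i j * p.[xi j] = p^`().[xi i].
Proof.
move=> sp; rewrite [in RHS](lagrange_interpolation sp) raddf_sum horner_sum.
by apply: eq_bigr => j _; rewrite mxE /= derivZ hornerZ mulrC.
Qed.

Lemma matQE i j : matQ xi w i j = w i * matD xi i j.
Proof. by rewrite /matQ /matM mul_diag_mx !mxE. Qed.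

Lemma matBE (i j : 'I_N.+1) :
  matB N i j = ((i == ord_max) && (j == ord_max))%:R
             - ((i == ord0) && (j == ord0))%:R :> R.
Proof. by rewrite !mxE. Qed.

Lemma sum_matB (X : 'I_N.+1 -> 'I_N.+1 -> R) :
  \sum_i \sum_j matB N i j * X i j = X ord_max ord_max - X ord0 ord0.
Proof.
have d (e : 'I_N.+1) :
    \sum_i \sum_j ((i == e) && (j == e))%:R * X i j = X e e.
  rewrite (bigD1 e) //= (bigD1 e) //= !eqxx mul1r big1 ?addr0 => [|j /negbTE->];
    last by rewrite mul0r.
  rewrite big1 ?addr0 // => i /negbTE ->.
  by rewrite big1 // => j _; rewrite mul0r.
rewrite -!d -sumrB; apply: eq_bigr => i _; rewrite -sumrB.
by apply: eq_bigr => j _; rewrite matBE mulrBl.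
Qed.

Hypothesis hSBP : SBP xi w.
Hypotheses (xi_first : xi ord0 = -1) (xi_last : xi ord_max = 1).

Lemma SBP_entry i j : matQ xi w i j + matQ xi w j i = matB N i j.
Proof. by have /matrixP/(_ i j) := hSBP; rewrite !mxE. Qed.

(** Pair [Q + Q^T = B] with the nodal values of [p] and [q]. As [D] is exact on each factor, the two
    halves of the left side assemble the product rule. *)
Lemma quadrature_mul (p q : {poly R}) :
  (size p <= N.+1)%N -> (size q <= N.+1)%N ->
  \sum_i w i * (p * q)^`().[xi i] = (p * q).[1] - (p * q).[-1].
Proof.
move=> sp sq; rewrite -xi_first -xi_last.
have := sum_matB (fun i j => p.[xi i] * q.[xi j]); rewrite !hornerM => <-.
under [RHS]eq_bigr do under eq_bigr do rewrite -SBP_entry mulrDl.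
under [RHS]eq_bigr do rewrite big_split /=.
rewrite big_split /= [X in _ + X]exchange_big /= -big_split /=.
apply: eq_bigr => i _; rewrite derivM hornerD !hornerM.
rewrite -(matD_horner i sp) -(matD_horner i sq) mulrDr addrC.
rewrite mulr_sumr mulr_sumr mulr_suml mulr_sumr; congr (_ + _).
  by apply: eq_bigr => j _; rewrite matQE; ring.
by apply: eq_bigr => j _; rewrite matQE; ring.
Qed.

Lemma quadrature_exact (p : {poly R}) : (size p <= N.*2.+1)%N ->
  \sum_i w i * p^`().[xi i] = p.[1] - p.[-1].
Proof.
move=> sp.
(* Each monomial of degree k <= 2N is a product of two factors of degree at most N. The subtraction
   [k - N] is truncated, so the second factor is 1 when k <= N. *)
have -> : p = \sum_(k < size p) p`_k *: ('X^(minn k N) * 'X^(k - N)).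
  rewrite -[LHS]coefK poly_def; apply: eq_bigr => k _.
  by rewrite -exprD minnE; congr (_ *: 'X^_); lia.
rewrite raddf_sum !horner_sum -sumrB.
under eq_bigr do rewrite horner_sum mulr_sumr.
rewrite exchange_big; apply: eq_bigr => k _ /=.
rewrite !hornerZ -mulrBr -quadrature_mul ?mulr_sumr.
- by apply: eq_bigr => i _; rewrite /= derivZ hornerZ; ring.
- by rewrite size_polyXn ltnS geq_minr.
- move: (leq_trans (ltn_ord k) sp).
  by rewrite size_polyXn -addnn !ltnS leq_subLR.
Qed.

Lemma antiderivative (p : {poly R}) :
  exists2 q : {poly R}, q^`() = p & (size q <= (size p).+1)%N.
Proof.
exists (\poly_(i < (size p).+1) (p`_i.-1 / i%:R)); last exact: size_poly.
apply/polyP => i; rewrite coef_deriv coef_poly ltnS; case: ltnP => [_|h].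
  by rewrite /= -[LHS]mulr_natr divfK // pnatr_eq0.
by rewrite mul0rn nth_default.
Qed.

(** The sum is the increment over [-1, 1] of an antiderivative, which is monotone. If the increment
    were zero, the antiderivative would be constant on the interval, hence constant as a polynomial,
    and [p] would vanish. *)
Lemma quadrature_pos (p : {poly R}) : (size p <= N.*2)%N -> p != 0 ->
  (forall x, -1 < x < 1 -> 0 <= p.[x]) -> 0 < \sum_i w i * p.[xi i].
Proof.
move=> sp p0 pge0; have [q qp sq] := antiderivative p.
have mono : {in `[-1, 1] &, {homo (horner q) : x y / x <= y :> R}}.
  apply: ler_hornerW => x; rewrite qp in_itv /= => xi1; exact: pge0.
rewrite -qp quadrature_exact; last by rewrite (leq_trans sq).
have le11 : -1 <= 1 :> R by rewrite -subr_ge0 opprK addr_ge0.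
have m1 : (-1 : R) \in `[-1, 1] by rewrite in_itv /= lexx.
have p1 : (1 : R) \in `[-1, 1] by rewrite in_itv /= lexx andbT.
have mle x y : x \in `[-1, 1] -> y \in `[-1, 1] -> x <= y -> q.[x] <= q.[y].
  exact: mono.
rewrite subr_gt0 lt_neqAle mle // andbT.
apply: contraNN p0 => /eqP e; rewrite -qp.
suff -> : q = (q.[1])%:P by rewrite derivC.
apply/eqP; rewrite -subr_eq0; apply/eqP.
(* Any sufficiently many distinct points of [-1, 1] would do; there must be at least as many as the
   size of [q - q.[1]], and [maxn] accounts for the constant. *)
pose s : seq R := [seq k.+1%:R^-1 | k <- iota 0 (maxn (size q) 1)].
apply: (@roots_geq_poly_eq0 _ _ s).
- apply/allP => _ /mapP[k _ ->]; rewrite rootE !hornerE subr_eq0.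
  have kin : (k.+1%:R^-1 : R) \in `[-1, 1].
    have : 0 < k.+1%:R^-1 :> R by rewrite invr_gt0 ltr0n.
    have : k.+1%:R^-1 <= 1 :> R by rewrite invf_le1 ?ltr0n // ler1n.
    rewrite in_itv /= => -> k0; rewrite andbT.
    exact: le_trans (lerN10 _) (ltW k0).
  have := kin; rewrite in_itv /= => /andP[k1 k2].
  by rewrite eq_le mle //= -e mle.
- rewrite map_inj_uniq ?iota_uniq // => a b /invr_inj/eqP.
  by rewrite eqr_nat => /eqP[].
- rewrite size_map size_iota; apply: leq_trans (size_polyD _ _) _.
  by rewrite size_polyN geq_max leq_maxl size_polyC /=; case: eqP => /=; lia.
Qed.

Hypothesis xi_incr : forall i j : 'I_N.+1, (i < j)%N -> xi i < xi j.

Lemma LGL_weight_gt0 (j : 'I_N.+1) : (0 < N)%N -> 0 < w j.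
Proof.
move=> N0.
(* The test polynomial (l r q^2) is nonnegative on [-1, 1], has degree at most
   2N - 1 and vanishes at every node but xi j. *)
pose I := [pred m : 'I_N.+1 | [&& m != ord0, m != ord_max & m != j]].
pose q : {poly R} := \prod_(m | I m) ('X - (xi m)%:P).
(* The endpoint factors keep their sign on [-1, 1], so they need no square; squaring them too would
   raise the degree to 2N, beyond the exactness of the quadrature. *)
pose l : {poly R} := if j == ord0 then 1 else 'X + 1%:P.
pose r : {poly R} := if j == ord_max then 1 else 1%:P - 'X.
have bnd x : -1 < x < 1 -> 0 <= (l * r * (q * q)).[x].
  move=> h; rewrite !hornerM mulr_ge0 -?expr2 ?sqr_ge0 // mulr_ge0 //.
    by rewrite /l; case: ifP; rewrite !hornerE //; lra.
  by rewrite /r; case: ifP; rewrite !hornerE //; lra.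
have xlt i : i != ord_max -> xi i < 1.
  move=> h; rewrite -xi_last; apply: xi_incr; have := ltn_ord i.
  by rewrite ltnS leq_eqVlt => /orP[/eqP e|//]; case/eqP: h; apply/val_inj.
have xgt i : i != ord0 -> -1 < xi i.
  by move=> h; rewrite -xi_first; apply: xi_incr; rewrite lt0n.
have posj : 0 < (l * r * (q * q)).[xi j].
  rewrite !hornerM; apply: mulr_gt0; first apply: mulr_gt0.
  - by rewrite /l; case: (eqVneq j ord0) => [|/xgt]; rewrite !hornerE //; lra.
  - by rewrite /r; case: (eqVneq j ord_max) => [|/xlt]; rewrite !hornerE //;
    lra.
  - rewrite -expr2 exprn_even_gt0 //= /q horner_prod prodf_seq_neq0.
    apply/allP => m _; apply/implyP => /and3P[_ _ mj].
    by rewrite !hornerE subr_eq0 (inj_eq xi_inj) eq_sym.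
have zero i : i != j -> (l * r * (q * q)).[xi i] = 0.
  move=> ij; rewrite !hornerM; have [i0|i0] := eqVneq i ord0.
    suff -> : l.[xi i] = 0 by rewrite !mul0r.
    by rewrite /l -i0 eq_sym (negbTE ij) i0 xi_first !hornerE addNr.
  have [i1|i1] := eqVneq i ord_max.
    suff -> : r.[xi i] = 0 by rewrite mulr0 mul0r.
    by rewrite /r -i1 eq_sym (negbTE ij) i1 xi_last !hornerE subrr.
  have Ii : I i by rewrite /= i0 i1.
  suff -> : q.[xi i] = 0 by rewrite !mulr0.
  by rewrite /q horner_prod (bigD1 i) //= !hornerE subrr mul0r.
have p0 : l * r * (q * q) != 0.
  by apply: contraTneq posj => ->; rewrite horner0 ltxx.
have : 0 < \sum_i w i * (l * r * (q * q)).[xi i].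
  apply: quadrature_pos => //.
  have sl : (size l <= (j != ord0).+1)%N.
    by rewrite /l; case: eqP => _; rewrite ?size_poly1 // size_XaddC.
  have sr : (size r <= (j != ord_max).+1)%N.
    rewrite /r; case: eqP => _; rewrite ?size_poly1 //.
    by rewrite -size_polyN opprB size_XsubC.
  have sq : (size q <= #|I|.+1)%N.
    by rewrite /q -big_filter size_prod_XsubC cardE /enum_mem.
  (* The count gives degree 2 + 2(N - 2) for an interior [j] and 1 + 2(N - 1) = 2N - 1 for an
     endpoint; the latter exhausts the bound of [quadrature_pos]. *)
  have cI : (#|I| + ((j != ord0) && (j != ord_max)) + 2 = N.+1)%N.
    have := cardsC (j |: [set ord0; ord_max]); rewrite cardsU1 cards2 card_ord.
    rewrite !inE negb_or (_ : ord0 != ord_max); last first.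
      by apply/eqP => /(congr1 val) /= e; rewrite -e in N0.
    rewrite addnC addnA => h; apply: etrans h; congr (_ + _ + _)%N.
    by apply: eq_card => i; rewrite !inE !negb_or [RHS]andbC -andbA.
  have s1 := size_polyMleq l r; have s2 := size_polyMleq q q.
  have s3 := size_polyMleq (l * r) (q * q).
  rewrite -addnn; move: sl sr sq cI s1 s2 s3.
  case: (j != ord0); case: (j != ord_max) => /=; lia.
rewrite (bigD1 j) //= big1 ?addr0 => [|i ij]; last by rewrite zero ?mulr0.
by rewrite pmulr_lgt0.
Qed.
End Quadrature.

(** * Symmetry of the nodes and weights *)

Section Symmetry.
Context {R : realType}.

Lemma legendre_pairS n : legendre_pair n =
  (legendre n, legendre n.+1) :> {poly R} * {poly R}.
Proof. by rewrite /legendre /=; case: (legendre_pair n). Qed.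

Lemma legendre_rec n : legendre n.+2 = n.+2%:R^-1 *:
  (n.*2.+3%:R *: ('X * legendre n.+1) - n.+1%:R *: legendre n) :> {poly R}.
Proof. by rewrite {1}/legendre /= legendre_pairS. Qed.

Lemma size_legendre n : size (legendre n : {poly R}) = n.+1.
Proof.
suff : size (legendre n : {poly R}) = n.+1 /\
       size (legendre n.+1 : {poly R}) = n.+2 by case.
elim: n => [|n [IH1 IH2]]; first by rewrite /legendre /= size_poly1 size_polyX.
split=> //; rewrite legendre_rec size_scale ?invr_eq0 ?pnatr_eq0 //.
have nz : legendre n.+1 != 0 :> {poly R} by rewrite -size_poly_eq0 IH2.
have e : size (n.*2.+3%:R *: ('X * legendre n.+1 : {poly R})) = n.+3.
  by rewrite size_scale ?pnatr_eq0 // mulrC size_mulX // IH2.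
rewrite size_polyDl ?e // size_polyN.
by rewrite (leq_ltn_trans (size_scale_leq _ _)) // IH1 ltnS ltnW.
Qed.

Lemma legendre_parity n :
  legendre n \Po (- 'X) = (-1) ^+ n *: legendre n :> {poly R}.
Proof.
suff : legendre n \Po (- 'X) = (-1) ^+ n *: legendre n :> {poly R} /\
  legendre n.+1 \Po (- 'X) = (-1) ^+ n.+1 *: legendre n.+1 :> {poly R} by case.
elim: n => [|n [IH1 IH2]].
  by rewrite /legendre /= comp_polyC comp_polyX scale1r expr1 scaleN1r.
split=> //; rewrite legendre_rec comp_polyZ comp_polyB !comp_polyZ comp_polyM.
rewrite comp_polyX IH1 IH2 !exprS -!mul_polyC !(polyCM, polyCN).
by ring.
Qed.

Variables (N : nat) (xi w : 'I_N.+1 -> R).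
Hypothesis hLGL : is_LGL xi w.

Lemma LGL_inj : injective xi.
Proof.
move=> i j e; apply/val_inj; have [ij|ij|//] := ltngtP (val i) (val j).
  by have := LGL_incr hLGL ij; rewrite e ltxx.
by have := LGL_incr hLGL ij; rewrite e ltxx.
Qed.

(** All N + 1 nodes are roots of (X^2 - 1) L_N', which has degree at most N + 1, so they are all of
    its roots. Parity of L_N makes the set of roots symmetric, and the reversed negated list of
    nodes is again increasing, hence equal to the list itself. *)
Lemma LGL_rev (i : 'I_N.+1) : (0 < N)%N -> xi (rev_ord i) = - xi i.
Proof.
move=> N0.
pose d : {poly R} := (legendre N)^`().
pose p : {poly R} := ('X - 1%:P) * ('X + 1%:P) * d.
have d0 : d != 0.
  by rewrite /d -size_poly_eq0 size_deriv size_legendre -lt0n.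
have p0 : p != 0.
  rewrite !mulf_neq0 // ?polyXsubC_eq0 // -size_poly_eq0.
  by rewrite size_XaddC.
have sp : (size p <= N.+2)%N.
  have s1 := size_polyMleq ('X - 1%:P : {poly R}) ('X + 1%:P).
  have s2 := size_polyMleq (('X - 1%:P) * ('X + 1%:P) : {poly R}) d.
  have : size d = N by rewrite /d size_deriv size_legendre.
  rewrite size_XsubC size_XaddC in s1 => e; rewrite -/p e in s2.
  by apply: leq_trans s2 _; move: (leq_add s1 (leqnn N)); case: (_ + N)%N.
have dE x : root d (- x) = root d x.
  have := congr1 (fun q => (deriv q).[x]) (legendre_parity N).
  rewrite deriv_comp derivN derivX derivZ -/d mulrN1 !hornerE horner_comp
    !hornerE.
  rewrite /root => /eqP; rewrite eqr_oppLR => /eqP ->.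
  by rewrite -mulNr mulf_eq0 oppr_eq0 signr_eq0.
have rE x : root p x = [|| x == 1, x == -1 | root d x].
  rewrite /p !rootM root_XsubC -orbA; congr (_ || (_ || _)).
  by rewrite rootE hornerD hornerX hornerC addr_eq0.
have pr (k : 'I_N.+1) : root p (xi k).
  rewrite rE; case: (posnP k) => [k0|k0].
    rewrite (_ : k = ord0); last exact/val_inj.
    by rewrite (LGL_first hLGL) eqxx orbT.
  have [kN|kN] := ltnP k N; first by rewrite (LGL_inner hLGL) ?orbT ?k0.
  rewrite (_ : k = ord_max); last first.
    by apply/val_inj/eqP; rewrite eqn_leq kN -ltnS ltn_ord.
  by rewrite (LGL_last hLGL) eqxx.
have prN x : root p (- x) = root p x.
  by rewrite !rE dE eqr_opp eqr_oppLR orbCA.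
pose s := [seq xi k | k <- enum 'I_N.+1].
pose s' := [seq - xi (rev_ord k) | k <- enum 'I_N.+1].
have rs x : root p x -> x \in s.
  move=> rx; apply/negPn/negP => xs.
  suff : p = 0 by apply/eqP.
  apply: (@roots_geq_poly_eq0 _ p (x :: s)).
  - by rewrite /= rx; apply/allP => _ /mapP[k _ ->].
  - by rewrite /= xs map_inj_uniq ?enum_uniq //; apply: LGL_inj.
  - by rewrite /= size_map size_enum_ord.
have sorted_of (f : 'I_N.+1 -> R) :
    (forall a b : 'I_N.+1, (a < b)%N -> f a < f b) ->
    sorted <%R [seq f k | k <- enum 'I_N.+1].
  move=> fi; rewrite sorted_map; apply: (@sub_sorted _ (relpre val ltn)).
    by move=> a b /fi.
  by rewrite -sorted_map val_enum_ord iota_ltn_sorted.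
have ss : sorted <%R s by apply: sorted_of; apply: LGL_incr hLGL.
have ss' : sorted <%R s'.
  apply: sorted_of => a b ab; rewrite ltrN2; apply: (LGL_incr hLGL).
  by rewrite /=; have := ltn_ord b; lia.
have e : s' = s.
  have sub : {subset s' <= s}.
    by move=> _ /mapP[k _ ->]; apply: rs; rewrite prN.
  apply: (lt_sorted_eq ss' ss).
  by have [|_ + x] := uniq_min_size (lt_sorted_uniq ss') sub;
    rewrite ?size_map // => ->.
have nthE (j : 'I_N.+1) (f : 'I_N.+1 -> R) : nth 0 (map f (enum 'I_N.+1)) j =
  f j.
  by rewrite (nth_map i 0 f) ?size_enum_ord // nth_ord_enum.
by rewrite -[xi i](nthE i xi) -/s -e nthE opprK.
Qed.

Hypothesis hSBP : SBP xi w.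

(** If q' is the Lagrange polynomial at node [i], exactness gives w_i = q(1) - q(-1). The reflection
    -q(-x) has the same increment, and its derivative is 1 at the mirrored node and 0 at the
    others. *)
Lemma LGL_weight_rev (i : 'I_N.+1) : (0 < N)%N -> w (rev_ord i) = w i.
Proof.
move=> N0.
have x0 := LGL_first hLGL; have x1 := LGL_last hLGL.
have quad := quadrature_exact LGL_inj hSBP x0 x1.
have [q dq sq] := antiderivative (lagrange_poly xi i).
have sq' : (size q <= N.*2.+1)%N.
  rewrite (leq_trans sq) // ltnS (leq_trans (size_lagrange_poly xi i)) //.
  by rewrite -addnn -addn1 leq_add2l.
have wE : w i = q.[1] - q.[-1].
  rewrite -quad // (bigD1 i) //= big1 ?addr0 => [|j /negbTE ji].
    by rewrite dq lagrange_node ?eqxx ?mulr1 //; apply: LGL_inj.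
  by rewrite dq lagrange_node ?ji ?mulr0 //; apply: LGL_inj.
have -> : w i = (- (q \Po (- 'X))).[1] - (- (q \Po (- 'X))).[-1].
  by rewrite wE !(hornerN, horner_comp, hornerX) !opprK addrC.
rewrite -quad; last first.
  rewrite size_polyN size_comp_poly2 // -size_polyN opprK size_polyX //.
under [RHS]eq_bigr do rewrite derivN deriv_comp derivN derivX mulrN1 opprK
  horner_comp.
rewrite (bigD1 (rev_ord i)) //= big1 ?addr0 => [|j ji].
  by rewrite dq !hornerE LGL_rev // opprK lagrange_node ?eqxx ?mulr1 //;
    apply: LGL_inj.
rewrite dq !hornerE -LGL_rev // lagrange_node; last exact: LGL_inj.
by rewrite (inv_eq (@rev_ordK _)) (negbTE ji) mulr0.
Qed.

End Symmetry.

(** * Summation-by-parts identities *)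

Section SummationByParts.
Context {R : realType} {N : nat}.
Variables (xi w : 'I_N.+1 -> R).
Hypotheses (xi_inj : injective xi) (hSBP : SBP xi w).
Local Notation Q := (matQ xi w).

Lemma sum_matD i : \sum_m matD xi i m = 0.
Proof.
have h : (size (1%:P : {poly R})%R <= N.+1)%N by rewrite polyC1 size_poly1.
have := matD_horner xi_inj i h; rewrite derivC horner0 => {2}<-.
by apply: eq_bigr => m _; rewrite hornerC mulr1.
Qed.

Lemma sum_matQ i : \sum_m Q i m = 0.
Proof.
under eq_bigr do rewrite matQE.
by rewrite -mulr_sumr sum_matD mulr0.
Qed.

Lemma SBP_swap (X : 'I_N.+1 -> 'I_N.+1 -> R) :
  \sum_i \sum_m Q i m * X m i =
  X ord_max ord_max - X ord0 ord0 - \sum_i \sum_m Q i m * X i m.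
Proof.
apply/eqP; rewrite eq_sym subr_eq; apply/eqP.
rewrite -sum_matB [X in X + _]exchange_big -big_split /=.
apply: eq_bigr => i _; rewrite -big_split; apply: eq_bigr => m _.
by rewrite -(SBP_entry hSBP) /=; ring.
Qed.

(** The factor 2 of flux differencing provides two copies of the sum. One is transposed by summation
    by parts, and symmetry of [X] lets it recombine with the other into differences of [c]. *)
Lemma SBP_sym_test (c : 'I_N.+1 -> R) (X : 'I_N.+1 -> 'I_N.+1 -> R) :
  (forall i m, X i m = X m i) ->
  \sum_i c i * (\sum_m 2 * Q i m * X i m) =
  c ord_max * X ord_max ord_max - c ord0 * X ord0 ord0
  + \sum_i \sum_m Q i m * ((c i - c m) * X i m).
Proof.
move=> sX.
have -> : c ord_max * X ord_max ord_max - c ord0 * X ord0 ord0 =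
  \sum_i \sum_m Q i m * (c i * X i m) + \sum_i \sum_m Q i m * (c m * X m i).
  by rewrite (SBP_swap (fun i m => c i * X i m)) [RHS]addrC subrK.
rewrite -!big_split; apply: eq_bigr => i _; rewrite -!big_split mulr_sumr.
by apply: eq_bigr => m _; rewrite /= (sX m i); ring.
Qed.

(** Rows of [Q] sum to zero, so the part y_i p_i contributes nothing and summation by parts handles
    the mixed products. For constant [y] this is plain telescoping; in general [Q y], the discrete
    derivative of the metric term, remains. *)
Lemma SBP_mean_jump (y p : 'I_N.+1 -> R) :
  \sum_i \sum_m Q i m * (mean (y i) (y m) * (p m - p i)) =
  y ord_max * p ord_max - y ord0 * p ord0 - \sum_i p i * (\sum_m Q i m * y m).
Proof.
have E1 := SBP_swap (fun i m => y m * p m).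
have E2 := SBP_swap (fun i m => y i * p m).
have E3 := SBP_swap (fun i m => mean (y i) (y m) * p m).
have z : \sum_i \sum_m Q i m * (y i * p i) = 0.
  by apply: big1 => i _; rewrite -mulr_suml sum_matQ mul0r.
have m2 : \sum_i \sum_m Q i m * (mean (y i) (y m) * p m) =
   (\sum_i \sum_m Q i m * (y m * p m) + \sum_i \sum_m Q i m * (y i * p m)) / 2.
  rewrite -big_split mulr_suml; apply: eq_bigr => i _.
  rewrite -big_split mulr_suml; apply: eq_bigr => m _.
  by rewrite /mean /=; field.
have -> : \sum_i \sum_m Q i m * (mean (y i) (y m) * (p m - p i)) =
   \sum_i \sum_m Q i m * (mean (y i) (y m) * p m) -
   \sum_i \sum_m Q i m * (mean (y m) (y i) * p i).
  rewrite -sumrB; apply: eq_bigr => i _; rewrite -sumrB.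
  by apply: eq_bigr => m _; rewrite /mean /=; field.
have -> : \sum_i p i * (\sum_m Q i m * y m) =
    \sum_i \sum_m Q i m * (y m * p i).
  by apply: eq_bigr => i _; rewrite mulr_sumr; apply: eq_bigr => m _; ring.
move: E1 E2 E3; rewrite z /= => E1 E2 ->; rewrite E2 m2.
move: E1; rewrite /mean; set A := \sum_i _; set B := \sum_i _ => E1.
have -> : A = y ord_max * p ord_max - y ord0 * p ord0
  by rewrite -[LHS]add0r E1; ring.
by field.
Qed.

(** Write {{s}} [[b]] as (s_i b_m - s_m b_i)/2 plus the jump of s b / 2. Transposing the
    antisymmetric part doubles s_i b_m, the jump falls under [SBP_mean_jump], and the two end
    contributions cancel. *)
Lemma SBP_mean_jump_mul (y s b : 'I_N.+1 -> R) :
  \sum_i \sum_m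
    Q i m * (mean (y i) (y m) * (mean (s i) (s m) * (b m - b i))) =
  \sum_i \sum_m Q i m * (mean (y i) (y m) * (s i * b m))
  - \sum_i s i * b i / 2 * (\sum_m Q i m * y m).
Proof.
have E1 := SBP_mean_jump y (fun i => s i * b i / 2).
have E2 := SBP_swap (fun i m => mean (y i) (y m) * (s i * b m) / 2).
have -> : \sum_i \sum_m
     Q i m * (mean (y i) (y m) * (mean (s i) (s m) * (b m - b i))) =
   \sum_i \sum_m Q i m * (mean (y i) (y m) * (s i * b m) / 2)
   - \sum_i \sum_m Q i m * (mean (y m) (y i) * (s m * b i) / 2)
   + \sum_i \sum_m Q i m *
        (mean (y i) (y m) * (s m * b m / 2 - s i * b i / 2)).
  rewrite -sumrB -big_split; apply: eq_bigr => i _.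
  rewrite -sumrB -big_split; apply: eq_bigr => m _.
  by rewrite /mean /=; field.
rewrite {}E1 {}E2.
have -> : \sum_i \sum_m Q i m * (mean (y i) (y m) * (s i * b m)) =
    2 * \sum_i \sum_m Q i m * (mean (y i) (y m) * (s i * b m) / 2).
  rewrite mulr_sumr; apply: eq_bigr => i _; rewrite mulr_sumr.
  by apply: eq_bigr => m _; field.
by rewrite /mean; field.
Qed.

Definition dot (p q : 'cV[R]_3) : R := \sum_k p k 0 * q k 0.

(** One grid line and one flux. The second sum on the left is the discrete s D b, to be supplied by
    the source; the last sum on the right can disappear only after the other coordinate direction is
    added. *)
Lemma flux_difference_entropy (g : R) (V : 'I_N.+1 -> 'I_N.+1 -> 'cV[R]_3)
    (q : 'I_N.+1 -> 'cV[R]_3) (psi s b y : 'I_N.+1 -> R) :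
  (forall i m, V i m = V m i) ->
  (forall i m, dot (q m - q i) (V i m) =
     psi m - psi i + g * (mean (s i) (s m) * (b m - b i))) ->
  \sum_i \sum_k
    q i k 0 * (\sum_m 2 * Q i m * (V i m k 0 * mean (y i) (y m)))
  + g * \sum_i \sum_m Q i m * (mean (y i) (y m) * (s i * b m)) =
  y ord_max * (dot (q ord_max) (V ord_max ord_max) - psi ord_max)
  - y ord0 * (dot (q ord0) (V ord0 ord0) - psi ord0)
  + \sum_i (psi i + g * s i * b i / 2) * (\sum_m Q i m * y m).
Proof.
move=> sV hV; rewrite exchange_big /=.
have sX k i m : V i m k 0 * mean (y i) (y m) = V m i k 0 * mean (y m) (y i).
  by rewrite sV /mean [y i + _]addrC.
under eq_bigr => k _ do rewrite (SBP_sym_test (fun i => q i k 0) (sX k)).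
rewrite big_split sumrB /=.
have -> : \sum_k \sum_i \sum_m
     Q i m * ((q i k 0 - q m k 0) * (V i m k 0 * mean (y i) (y m))) =
   - \sum_i \sum_m Q i m * (mean (y i) (y m) * (psi m - psi i))
   - g * \sum_i \sum_m
       Q i m * (mean (y i) (y m) * (mean (s i) (s m) * (b m - b i))).
  rewrite exchange_big mulr_sumr -sumrN -sumrB; apply: eq_bigr => i _.
  rewrite exchange_big mulr_sumr -sumrN -sumrB; apply: eq_bigr => m _ /=.
  transitivity (- (Q i m * mean (y i) (y m) * dot (q m - q i) (V i m))).
    rewrite /dot mulr_sumr -sumrN; apply: eq_bigr => k _; rewrite !mxE; ring.
  by rewrite hV; ring.
rewrite SBP_mean_jump SBP_mean_jump_mul.
have dE e : \sum_k q e k 0 * (V e e k 0 * mean (y e) (y e)) =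
     y e * dot (q e) (V e e).
  by rewrite /dot mulr_sumr; apply: eq_bigr => k _; rewrite /mean; field.
rewrite !dE.
have -> : \sum_i (psi i + g * s i * b i / 2) * (\sum_m Q i m * y m) =
   \sum_i psi i * (\sum_m Q i m * y m) +
   g * \sum_i s i * b i / 2 * (\sum_m Q i m * y m).
  by rewrite mulr_sumr -big_split; apply: eq_bigr => i _; rewrite /=; ring.
ring.
Qed.

End SummationByParts.

(** * Two-point fluxes and entropy *)

Section ShallowWaterEntropy.
Context {R : realType}.
Variable g : R.
Implicit Types (a : 'cV[R]_3) (z l r : @trace R).

Lemma sum3 (f : 'I_3 -> R) : \sum_k f k = f k1 + f k2 + f k3.
Proof.
rewrite !big_ord_recl big_ord0 addr0 addrA.
by congr (_ + _ + _); congr f; apply/val_inj.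
Qed.

Lemma col3E (a b c : R) :
  (col3 a b c k1 0 = a) * (col3 a b c k2 0 = b) * (col3 a b c k3 0 = c).
Proof. by rewrite !mxE. Qed.

Lemma dotE (p q : 'cV[R]_3) :
  dot p q = p k1 0 * q k1 0 + p k2 0 * q k2 0 + p k3 0 * q k3 0.
Proof. exact: sum3. Qed.

Lemma dotBl (p q f : 'cV[R]_3) : dot (p - q) f = dot p f - dot q f.
Proof. by rewrite -sumrB; apply: eq_bigr => k _; rewrite !mxE mulrBl. Qed.

Lemma dotBr (p q f : 'cV[R]_3) : dot f (p - q) = dot f p - dot f q.
Proof. by rewrite -sumrB; apply: eq_bigr => k _; rewrite !mxE mulrBr. Qed.

Lemma dotZr c (p f : 'cV[R]_3) : dot f (c *: p) = c * dot f p.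
Proof. by rewrite mulr_sumr; apply: eq_bigr => k _; rewrite !mxE mulrCA. Qed.

(* The entropy potentials [dot q f - F] and [dot q g - G]. *)
Definition psi_f a : R := g * hgt a ^+ 2 * vel_u a / 2.
Definition psi_g a : R := g * hgt a ^+ 2 * vel_v a / 2.

Lemma mom_xE a : hgt a != 0 -> mom_x a = hgt a * vel_u a.
Proof. by move=> h; rewrite mulrC divfK. Qed.

Lemma mom_yE a : hgt a != 0 -> mom_y a = hgt a * vel_v a.
Proof. by move=> h; rewrite mulrC divfK. Qed.

Lemma Fvol_sym a (a' : 'cV[R]_3) : Fvol g a a' = Fvol g a' a.
Proof.
have avgC phi : avg phi a a' = avg phi a' a by rewrite /avg /mean addrC.
by rewrite /Fvol (avgC hgt) (avgC mom_x) (avgC vel_u) (avgC vel_v) (avgC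
  (fun y => hgt y ^+ 2)).
Qed.

Lemma Gvol_sym a (a' : 'cV[R]_3) : Gvol g a a' = Gvol g a' a.
Proof.
have avgC phi : avg phi a a' = avg phi a' a by rewrite /avg /mean addrC.
by rewrite /Gvol (avgC hgt) (avgC mom_y) (avgC vel_u) (avgC vel_v) (avgC
  (fun y => hgt y ^+ 2)).
Qed.

Lemma meanxx x : mean x x = x :> R.
Proof. by rewrite /mean; field. Qed.

Lemma Fvol_consistent a : hgt a != 0 -> Fvol g a a = flux_f g a.
Proof.
move=> h; rewrite /Fvol /flux_f /avg !meanxx mom_xE //.
by congr (col3 _ _ _); field.
Qed.

Lemma Gvol_consistent a : hgt a != 0 -> Gvol g a a = flux_g g a.
Proof.
move=> h; rewrite /Gvol /flux_g /avg !meanxx mom_yE //.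
by congr (col3 _ _ _); field.
Qed.

(** Kinetic terms cancel because [[u^2/2]] = {{u}} [[u]], and likewise for v. The pressure is g/2 h
    h', and [[h]] {{hu}} + h h' [[u]]/2 = [[h^2 u]]/2 gives the potential. *)
Lemma Fvol_entropy z (z' : @trace R) : hgt z.1 != 0 -> hgt z'.1 != 0 ->
  dot (entropy_vars g z' - entropy_vars g z) (Fvol g z.1 z'.1) =
  psi_f z'.1 - psi_f z.1
  + g * (mean (mom_x z.1) (mom_x z'.1) * (z'.2 - z.2)).
Proof.
move=> h h'; rewrite dotBl !dotE !col3E /avg !mom_xE // /psi_f /mean.
by field.
Qed.

Lemma Gvol_entropy z (z' : @trace R) : hgt z.1 != 0 -> hgt z'.1 != 0 ->
  dot (entropy_vars g z' - entropy_vars g z) (Gvol g z.1 z'.1) =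
  psi_g z'.1 - psi_g z.1
  + g * (mean (mom_y z.1) (mom_y z'.1) * (z'.2 - z.2)).
Proof.
move=> h h'; rewrite dotBl !dotE !col3E /avg !mom_yE // /psi_g /mean.
by field.
Qed.

(** Here the pressure is g/2 {{h^2}}, and the potential comes from the product rule [[h^2]] {{u}} +
    {{h^2}} [[u]] = [[h^2 u]]. The bottom term carries {{h}} {{u}} rather than {{hu}}, which is why
    the interface source contains {{h}}. *)
Lemma Fec_entropy z (z' : @trace R) :
  dot (entropy_vars g z' - entropy_vars g z) (Fec g z.1 z'.1) =
  psi_f z'.1 - psi_f z.1
  + g * avg hgt z.1 z'.1 * avg vel_u z.1 z'.1 * (z'.2 - z.2).
Proof. by rewrite dotBl !dotE !col3E /avg /psi_f /mean; field. Qed.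

Lemma Gec_entropy z (z' : @trace R) :
  dot (entropy_vars g z' - entropy_vars g z) (Gec g z.1 z'.1) =
  psi_g z'.1 - psi_g z.1
  + g * avg hgt z.1 z'.1 * avg vel_v z.1 z'.1 * (z'.2 - z.2).
Proof. by rewrite dotBl !dotE !col3E /avg /psi_g /mean; field. Qed.

Lemma dot_congr_diag (A : 'M[R]_3) (d e : 'rV[R]_3) (x : 'cV[R]_3) :
  dot x (A *m diag_mx d *m diag_mx e *m A^T *m x) =
  \sum_k d 0 k * e 0 k * (A^T *m x) k 0 ^+ 2.
Proof.
have -> (y : 'cV[R]_3) : dot x y = (x^T *m y) 0 0.
  by rewrite mxE; apply: eq_bigr => k _; rewrite mxE.
rewrite -!mulmxA !mulmxA -[A in x^T *m A]trmxK -trmx_mul -!mulmxA.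
rewrite mxE; apply: eq_bigr => k _.
by rewrite !mul_diag_mx !mxE; ring.
Qed.

Lemma dissipation_ge0 (A : 'M[R]_3) s c h (x : 'cV[R]_3) : 0 < g -> 0 <= h ->
  0 <= dot x (A *m absLambda s c *m matZ g h *m A^T *m x).
Proof.
move=> g0 h0; rewrite dot_congr_diag; apply: sumr_ge0 => k _.
have g2 : 0 <= 1 / (2 * g) by rewrite divr_ge0 // mulr_ge0 // ltW.
rewrite mulr_ge0 ?sqr_ge0 // mulr_ge0 // !mxE.
  by case: k => [[|[|[|]]]] //=.
by case: k => [[|[|[|]]]] //=.
Qed.

Definition num_entropy_F l r : R :=
  (dot (entropy_vars g l) (Fes g l r) + dot (entropy_vars g r) (Fes g l r)) / 2
  - mean (psi_f l.1) (psi_f r.1)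
  - g / 4 * avg hgt l.1 r.1 * (r.2 - l.2) * (vel_u r.1 - vel_u l.1).

Definition num_entropy_G l r : R :=
  (dot (entropy_vars g l) (Ges g l r) + dot (entropy_vars g r) (Ges g l r)) / 2
  - mean (psi_g l.1) (psi_g r.1)
  - g / 4 * avg hgt l.1 r.1 * (r.2 - l.2) * (vel_v r.1 - vel_v l.1).

Lemma num_entropy_consistent :
  consistent_entropy_fluxes g num_entropy_F num_entropy_G.
Proof.
move=> z _; rewrite /num_entropy_F /num_entropy_G /Fes /Ges !subrr !mulmx0.
rewrite !scaler0 !subr0 !dotE !col3E /avg !meanxx /psi_f /psi_g.
rewrite /entropy_flux_F /entropy_flux_G.
by split; field.
Qed.

(* Entropy produced at an interface node of inner trace [z] and outer trace
   [z'], per unit of outward conormal, by the surface flux [F] and by the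
   jump part of the source. *)
Definition side_production_F (z z' : @trace R) (F : 'cV[R]_3) : R :=
  psi_f z.1 - dot (entropy_vars g z) F
  - g / 2 * avg hgt z.1 z'.1 * (z'.2 - z.2) * vel_u z.1.
Definition side_production_G (z z' : @trace R) (F : 'cV[R]_3) : R :=
  psi_g z.1 - dot (entropy_vars g z) F
  - g / 2 * avg hgt z.1 z'.1 * (z'.2 - z.2) * vel_v z.1.

(** After the velocity correction both sums reduce to the entropy identity of [Fec] plus
    dissipation: they equal -d/4 and d/4, with d the quadratic form at the jump of the entropy
    variables. The second one serves a negative outward conormal, where the inner trace is [r]. *)
Lemma side_production_F_le0 l r : 0 < g -> 0 < hgt l.1 -> 0 < hgt r.1 ->
  side_production_F l r (Fes g l r) + num_entropy_F l r <= 0 /\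
  0 <= side_production_F r l (Fes g l r) + num_entropy_F l r.
Proof.
move=> g0 hl hr; set h := avg hgt l.1 r.1.
set c := Num.sqrt (g * h); set u := avg vel_u l.1 r.1.
set v := avg vel_v l.1 r.1.
set x := entropy_vars g r - entropy_vars g l.
have h0 : 0 <= h by rewrite /h /avg /mean divr_ge0 // addr_ge0 ?ltW.
have := dissipation_ge0 (matRf u v c) u c x g0 h0.
have := dotBr (Fec g l.1 r.1) ((1 / 2) *: (matRf u v c *m absLambda u c *m
  matZ g h *m (matRf u v c)^T *m x)) x.
rewrite -[_ - _ *: _]/(Fes g l r) dotZr [dot x (Fec _ _ _)]Fec_entropy dotBl.
have hC : avg hgt r.1 l.1 = h by rewrite /h /avg /mean addrC.
have uE : u = (vel_u l.1 + vel_u r.1) / 2 by [].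
rewrite /side_production_F /num_entropy_F hC -/h -/u uE /mean.
move: (dot x (matRf _ _ _ *m _ *m _ *m _ *m _)) => d.
by split; lra.
Qed.

Lemma side_production_G_le0 l r : 0 < g -> 0 < hgt l.1 -> 0 < hgt r.1 ->
  side_production_G l r (Ges g l r) + num_entropy_G l r <= 0 /\
  0 <= side_production_G r l (Ges g l r) + num_entropy_G l r.
Proof.
move=> g0 hl hr; set h := avg hgt l.1 r.1.
set c := Num.sqrt (g * h); set u := avg vel_u l.1 r.1.
set v := avg vel_v l.1 r.1.
set x := entropy_vars g r - entropy_vars g l.
have h0 : 0 <= h by rewrite /h /avg /mean divr_ge0 // addr_ge0 ?ltW.
have := dissipation_ge0 (matRg u v c) v c x g0 h0.
have := dotBr (Gec g l.1 r.1) ((1 / 2) *: (matRg u v c *m absLambda v c *m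
  matZ g h *m (matRg u v c)^T *m x)) x.
rewrite -[_ - _ *: _]/(Ges g l r) dotZr [dot x (Gec _ _ _)]Gec_entropy dotBl.
have hC : avg hgt r.1 l.1 = h by rewrite /h /avg /mean addrC.
have uE : v = (vel_v l.1 + vel_v r.1) / 2 by [].
rewrite /side_production_G /num_entropy_G hC -/h -/v uE /mean.
move: (dot x (matRg _ _ _ *m _ *m _ *m _ *m _)) => d.
by split; lra.
Qed.

(** At rest the entropy variables are (g(h + b), 0, 0), hence continuous across the interface: the
    dissipation vanishes and only the mean pressure is left. *)
Lemma Fes_rest l r : vel_u l.1 = 0 -> vel_v l.1 = 0 -> vel_u r.1 = 0 ->
  vel_v r.1 = 0 -> hgt l.1 + l.2 = hgt r.1 + r.2 ->
  Fes g l r = col3 0 (g / 4 * (hgt l.1 ^+ 2 + hgt r.1 ^+ 2)) 0.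
Proof.
move=> ul vl ur vr e; rewrite /Fes /entropy_vars ul vl ur vr e subrr mulmx0.
rewrite scaler0 subr0 /Fec /avg ul vl ur vr /mean.
by congr (col3 _ _ _); field.
Qed.

Lemma Ges_rest l r : vel_u l.1 = 0 -> vel_v l.1 = 0 -> vel_u r.1 = 0 ->
  vel_v r.1 = 0 -> hgt l.1 + l.2 = hgt r.1 + r.2 ->
  Ges g l r = col3 0 0 (g / 4 * (hgt l.1 ^+ 2 + hgt r.1 ^+ 2)).
Proof.
move=> ul vl ur vr e; rewrite /Ges /entropy_vars ul vl ur vr e subrr mulmx0.
rewrite scaler0 subr0 /Gec /avg ul vl ur vr /mean.
by congr (col3 _ _ _); field.
Qed.

End ShallowWaterEntropy.

(** * Normals of glued sides *)

Section Conormals.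
Context {R : realType} {N : nat}.
Variables (xi w : 'I_N.+1 -> R).
Hypotheses (hN : (0 < N)%N) (hLGL : is_LGL xi w).

Lemma transfinite_west (c : side -> {poly R}) x :
  transfinite c (-1) x = (c west).[x].
Proof. by rewrite /transfinite; field. Qed.

Lemma d_eta_west c r : d_eta xi c ord0 r = (c west)^`().[xi r].
Proof.
rewrite mxE (LGL_first hLGL) [in RHS]derivE.
by under eq_fun do rewrite transfinite_west.
Qed.

Lemma transfinite_east (c : side -> {poly R}) x :
  transfinite c 1 x = (c east).[x].
Proof. by rewrite /transfinite; field. Qed.

Lemma d_eta_east c r : d_eta xi c ord_max r = (c east)^`().[xi r].
Proof.
rewrite mxE (LGL_last hLGL) [in RHS]derivE.
by under eq_fun do rewrite transfinite_east.
Qed.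

(** The corner terms of [transfinite] are end values of the south and north curves. On these two
    sides they have to cancel end values of the west and east curves, which is where
    [closed_boundary] enters. *)
Lemma transfinite_south (c : side -> {poly R}) x : closed_boundary c ->
  transfinite c x (-1) = (c south).[x].
Proof. by case=> e1 e2 e3 e4; rewrite /transfinite -?e1 -?e2 -?e3 -?e4;
  field. Qed.

Lemma d_xi_south c r : closed_boundary c -> d_xi xi c r ord0 =
  (c south)^`().[xi r].
Proof.
move=> cb; rewrite mxE (LGL_first hLGL) [in RHS]derivE.
by under eq_fun do rewrite (transfinite_south _ cb).
Qed.

Lemma transfinite_north (c : side -> {poly R}) x : closed_boundary c ->
  transfinite c x 1 = (c north).[x].
Proof. by case=> e1 e2 e3 e4; rewrite /transfinite -?e1 -?e2 -?e3 -?e4;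
  field. Qed.

Lemma d_xi_north c r : closed_boundary c -> d_xi xi c r ord_max =
  (c north)^`().[xi r].
Proof.
move=> cb; rewrite mxE (LGL_last hLGL) [in RHS]derivE.
by under eq_fun do rewrite (transfinite_north _ cb).
Qed.

Variables (T : finType) (m : @mesh R T).
Hypothesis hm : is_mesh xi m.

Definition outward_conormal K s r : R * R :=
  (outward s (conormal xi m K s r).1, outward s (conormal xi m K s r).2).

(** The outward normal is the counterclockwise tangent turned clockwise by a right angle, so it
    depends on the boundary curve of the side alone. This makes normals of neighbouring elements
    comparable. *)
Lemma outward_conormalE K s r : outward_conormal K s r =
  ((if ccw s then (my m K s)^`().[xi r] else - (my m K s)^`().[xi r]),
   (if ccw s then - (mx m K s)^`().[xi r] else (mx m K s)^`().[xi r])).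
Proof.
rewrite /outward_conormal /conormal /side_node /outward.
have [cx cy] := mesh_corner hm K.
case: s => [[] []] /=; rewrite /x_xi /x_eta /y_xi /y_eta /ccw /=.
- by rewrite !d_xi_north.
- by rewrite !d_xi_south // opprK.
- by rewrite !d_eta_east.
- by rewrite !d_eta_west opprK.
Qed.

Lemma match_nodeK s s' : cancel (match_node s s') (@match_node N s' s).
Proof.
move=> r; rewrite /match_node [ccw s' == _]eq_sym.
by case: eqP => // _; rewrite rev_ordK.
Qed.

(** The translation drops out on differentiation. If the parameters run in opposite directions, the
    chain rule gives the sign, and symmetry of the nodes identifies the mirrored abscissa with the
    reversed index. *)
Lemma glued_deriv s s' (p p' : {poly R}) r : glued s s' p p' ->
  p'^`().[xi (match_node s s' r)] =
  if ccw s == ccw s' then - p^`().[xi r] else p^`().[xi r].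
Proof.
case=> d ->; rewrite /match_node; case: eqP => _.
  rewrite derivD derivC addr0 deriv_comp derivN derivX mulrN1.
  by rewrite hornerN horner_comp hornerN hornerX (LGL_rev hLGL) // opprK.
by rewrite derivD derivC addr0.
Qed.

Lemma outward_conormal_nbr K s r K' s' : nbr m K s = Some (K', s') ->
  outward_conormal K' s' (match_node s s' r) =
  (- (outward_conormal K s r).1, - (outward_conormal K s r).2).
Proof.
move=> /(mesh_nbr hm)[_ gx gy].
rewrite !outward_conormalE (glued_deriv r gx) (glued_deriv r gy) /=.
by case: (ccw s); case: (ccw s'); rewrite /= ?opprK.
Qed.

End Conormals.

(** * Weak form of the scheme *)

Section WeakForm.
Context {R : realType} {N : nat}.
Variables (xi w : 'I_N.+1 -> R) (g : R).
Hypotheses (xi_inj : injective xi) (hSBP : SBP xi w).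
Hypothesis w_neq0 : forall i, w i != 0.
Local Notation D := (matD xi).

(** The coefficients [y1] and [y2] of the two fluxes are arbitrary, so this covers xi-lines and
    eta-lines alike. The quadrature weight cancels the factor 1/w_i of the flux-differencing sum. *)
Lemma line_weak (gam : R) (a : 'I_N.+1 -> 'cV[R]_3) (q : 'I_N.+1 -> 'cV[R]_3)
    (pf pg sf sg b y1 y2 : 'I_N.+1 -> R) :
  (forall i, hgt (a i) != 0) ->
  (forall i m, dot (q m - q i) (Fvol g (a i) (a m)) =
     pf m - pf i + gam * (mean (sf i) (sf m) * (b m - b i))) ->
  (forall i m, dot (q m - q i) (Gvol g (a i) (a m)) =
     pg m - pg i + gam * (mean (sg i) (sg m) * (b m - b i))) ->
  \sum_i w i * (\sum_k q i k 0 * ((w i)^-1 * \sum_m 2 * matQ xi w i m *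
     (Fvol g (a i) (a m) k 0 * mean (y1 i) (y1 m)
      + Gvol g (a i) (a m) k 0 * mean (y2 i) (y2 m)))) =
  y1 ord_max * (dot (q ord_max) (flux_f g (a ord_max)) - pf ord_max)
  + y2 ord_max * (dot (q ord_max) (flux_g g (a ord_max)) - pg ord_max)
  - (y1 ord0 * (dot (q ord0) (flux_f g (a ord0)) - pf ord0)
     + y2 ord0 * (dot (q ord0) (flux_g g (a ord0)) - pg ord0))
  + \sum_i w i * ((pf i + gam * sf i * b i / 2) * (\sum_m D i m * y1 m)
                  + (pg i + gam * sg i * b i / 2) * (\sum_m D i m * y2 m))
  - gam * \sum_i w i * (sf i * (\sum_m D i m * (mean (y1 i) (y1 m) * b m))
                        + sg i * (\sum_m D i m * (mean (y2 i) (y2 m) * b m))).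
Proof.
move=> h0 hF hG.
have EF := flux_difference_entropy xi_inj hSBP y1
  (fun i m => Fvol_sym g (a i) (a m)) hF.
have EG := flux_difference_entropy xi_inj hSBP y2
  (fun i m => Gvol_sym g (a i) (a m)) hG.
rewrite !Fvol_consistent // in EF; rewrite !Gvol_consistent // in EG.
have QD i (f : 'I_N.+1 -> R) : \sum_m matQ xi w i m * f m =
  w i * \sum_m D i m * f m.
  by rewrite mulr_sumr; apply: eq_bigr => m _; rewrite matQE mulrA.
have Qs y s : \sum_i \sum_m matQ xi w i m * (mean (y i) (y m) * (s i * b m)) =
    \sum_i w i * (s i * \sum_m D i m * (mean (y i) (y m) * b m)).
  apply: eq_bigr => i _; rewrite QD; congr (_ * _); rewrite mulr_sumr.
  by apply: eq_bigr => m _; ring.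
rewrite !Qs in EF EG.
transitivity
  (\sum_i \sum_k q i k 0 * (\sum_m 2 * matQ xi w i m *
      (Fvol g (a i) (a m) k 0 * mean (y1 i) (y1 m)))
   + \sum_i \sum_k q i k 0 * (\sum_m 2 * matQ xi w i m *
      (Gvol g (a i) (a m) k 0 * mean (y2 i) (y2 m)))).
  rewrite -big_split; apply: eq_bigr => i _.
  rewrite mulr_sumr -big_split; apply: eq_bigr => k _ /=.
  rewrite mulrCA mulVKf // -mulrDr -big_split; congr (_ * _).
  by apply: eq_bigr => m _ /=; rewrite -mulrDr.
move/(canRL (addrK _)): EF => ->; move/(canRL (addrK _)): EG => ->.
have -> : \sum_i w i * ((pf i + gam * sf i * b i / 2) * (\sum_m D i m * y1 m)
                  + (pg i + gam * sg i * b i / 2) * (\sum_m D i m * y2 m)) =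
  \sum_i (pf i + gam * sf i * b i / 2) * (\sum_m matQ xi w i m * y1 m) +
  \sum_i (pg i + gam * sg i * b i / 2) * (\sum_m matQ xi w i m * y2 m).
  rewrite -big_split; apply: eq_bigr => i _ /=; rewrite !QD mulrDr.
  by rewrite ![w i * (_ * _)]mulrCA.
have -> : \sum_i w i * (sf i * (\sum_m D i m * (mean (y1 i) (y1 m) * b m))
                        + sg i * (\sum_m D i m * (mean (y2 i) (y2 m) * b m))) =
   \sum_i w i * (sf i * (\sum_m D i m * (mean (y1 i) (y1 m) * b m))) +
   \sum_i w i * (sg i * (\sum_m D i m * (mean (y2 i) (y2 m) * b m))).
  by rewrite -big_split; apply: eq_bigr => i _ /=; rewrite mulrDr.
ring.
Qed.

Lemma delta_mulmx (e : 'I_N.+1) (A : 'M[R]_N.+1) i j :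
  (delta_mx e e *m A) i j = (i == e)%:R * A e j.
Proof.
rewrite mxE (bigD1 e) //= big1 ?addr0 => [|k /negbTE ke].
  by rewrite mxE eqxx andbT.
by rewrite mxE ke andbF mul0r.
Qed.

Lemma mulmx_delta (e : 'I_N.+1) (A : 'M[R]_N.+1) i j :
  (A *m delta_mx e e) i j = (j == e)%:R * A i e.
Proof.
rewrite mxE (bigD1 e) //= big1 ?addr0 => [|k /negbTE ke].
  by rewrite mxE eqxx /= mulrC.
by rewrite mxE ke /= mulr0.
Qed.

Lemma sum_deltaM (e : 'I_N.+1) (f : 'I_N.+1 -> R) :
  \sum_i (i == e)%:R * f i = f e.
Proof.
rewrite (bigD1 e) //= big1 ?addr0 => [|k /negbTE ->]; last by rewrite mul0r.
by rewrite eqxx mul1r.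
Qed.

Lemma matS_mulmx (A : 'M[R]_N.+1) i j : (matS w *m A) i j =
  (i == ord0)%:R * (A ord0 j / w ord0) - (i == ord_max)%:R
    * (A ord_max j / w ord_max).
Proof.
rewrite /matS mulmxBl -!scalemxAl [LHS]mxE [X in X + _]mxE [X in _
  + X]mxE [X in _ - X]mxE.
by rewrite !delta_mulmx; ring.
Qed.

Lemma mulmx_matS (A : 'M[R]_N.+1) i j : (A *m matS w) i j =
  (j == ord0)%:R * (A i ord0 / w ord0) - (j == ord_max)%:R
    * (A i ord_max / w ord_max).
Proof.
rewrite /matS mulmxBr -!scalemxAr [LHS]mxE [X in X + _]mxE [X in _
  + X]mxE [X in _ - X]mxE.
by rewrite !mulmx_delta; ring.
Qed.

Lemma matS_weak (c : 'I_N.+1 -> R) (A : 'M[R]_N.+1) j :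
  \sum_i w i * (c i * (matS w *m A) i j) =
  c ord0 * A ord0 j - c ord_max * A ord_max j.
Proof.
rewrite -(sum_deltaM ord0 (fun i => c i * A i j)).
rewrite -(sum_deltaM ord_max (fun i => c i * A i j)) -sumrB.
apply: eq_bigr => i _; rewrite matS_mulmx.
case: (eqVneq i ord0) => [->|_]; case: eqP => [->|_];
  rewrite ?mul0r ?mul1r ?subr0 ?sub0r; field; rewrite ?w_neq0 //.
Qed.

Lemma weak_matS (c : 'I_N.+1 -> R) (A : 'M[R]_N.+1) i :
  \sum_j w j * (c j * (A *m matS w) i j) =
  c ord0 * A i ord0 - c ord_max * A i ord_max.
Proof.
rewrite -(sum_deltaM ord0 (fun j => c j * A i j)).
rewrite -(sum_deltaM ord_max (fun j => c j * A i j)) -sumrB.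
apply: eq_bigr => j _; rewrite mulmx_matS.
case: (eqVneq j ord0) => [->|_]; case: eqP => [->|_];
  rewrite ?mul0r ?mul1r ?subr0 ?sub0r; field; rewrite ?w_neq0 //.
Qed.

End WeakForm.

(** * Contravariant coefficients and the split form of the source *)

Section ElementWeakForm.
Context {R : realType} {N : nat}.
Variables (xi w : 'I_N.+1 -> R) (g : R).
Hypotheses (xi_inj : injective xi) (hSBP : SBP xi w) (hN : (0 < N)%N).
Hypothesis w_neq0 : forall i, w i != 0.
Variables (T : finType) (m : @mesh R T) (oF oG : @orientation N T).
Hypothesis hmetric : metric_identities xi m.
Variables (U : @nodal_data R N T) (b : T -> 'M[R]_N.+1).
Variable ext : @boundary_data R N T.
Local Notation D := (matD xi).

Lemma mxE_add p n (A B : 'M[R]_(p, n)) i j : (A + B) i j = A i j + B i j.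
Proof. by rewrite mxE. Qed.

Lemma mxE_opp p n (A : 'M[R]_(p, n)) i j : (- A) i j = - A i j.
Proof. by rewrite mxE. Qed.

Lemma mxE_scale c (A : 'M[R]_N.+1) i j : (c *: A) i j = c * A i j.
Proof. by rewrite mxE. Qed.

Lemma mxE_hadamard (A B : 'M[R]_N.+1) i j : (A ⊙ B) i j = A i j * B i j.
Proof. by rewrite mxE. Qed.

Lemma matMinv_mulmx (A : 'M[R]_N.+1) i j : (matMinv w *m A) i j =
  (w i)^-1 * A i j.
Proof. by rewrite /matMinv mul_diag_mx !mxE. Qed.

Lemma mulmx_matMinv (A : 'M[R]_N.+1) i j : (A *m matMinv w) i j =
  (w j)^-1 * A i j.
Proof. by rewrite /matMinv mul_mx_diag !mxE mulrC. Qed.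

(* The coefficients of the fluxes f and g in the contravariant fluxes in the
   xi- and eta-directions. *)
Definition cov_xi K i j : R * R := (y_eta xi m K i j, - x_eta xi m K i j).
Definition cov_eta K i j : R * R := (- y_xi xi m K i j, x_xi xi m K i j).

Lemma sum_side (f : side -> R) :
  \sum_s f s = f west + f east + f south + f north.
Proof.
transitivity (\sum_p \sum_q f (p, q)).
  by rewrite pair_bigA; apply: eq_bigr => -[].
rewrite big_bool !big_bool /=.
by rewrite /west /east /south /north; ring.
Qed.

Lemma metric_cov K i j :
  \sum_n D i n * (cov_xi K n j).1 + \sum_n D j n * (cov_eta K i n).1 = 0 /\
  \sum_n D i n * (cov_xi K n j).2 + \sum_n D j n * (cov_eta K i n).2 = 0.
Proof.
have DT (A : 'M[R]_N.+1) : (A *m D^T) i j = \sum_n D j n * A i n.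
  by rewrite mxE; apply: eq_bigr => n _; rewrite [D^T n j]mxE mulrC.
have DA (A : 'M[R]_N.+1) : (D *m A) i j = \sum_n D i n * A n j by rewrite mxE.
have [/matrixP/(_ i j) e1 /matrixP/(_ i j) e2] := hmetric K.
move: e1 e2; rewrite [LHS]mxE [X in _ + X]mxE !(DA, DT) [RHS]mxE => e1.
rewrite [LHS]mxE [X in X + _]mxE !(DA, DT) [RHS]mxE => e2.
by split; [apply: etrans e1|apply: etrans e2]; congr (_ + _);
  rewrite -sumrN; apply: eq_bigr => n _; rewrite -mulrN.
Qed.

Lemma volPE K k i j : volP xi w g m U K k i j =
  (w i)^-1 * \sum_(n < N.+1) 2 * matQ xi w i n *
   (Fvol g (state U K i j) (state U K n j) k 0
      * mean (cov_xi K i j).1 (cov_xi K n j).1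
    + Gvol g (state U K i j) (state U K n j) k 0
      * mean (cov_xi K i j).2 (cov_xi K n j).2).
Proof.
rewrite mxE; congr (_ * _); apply: eq_bigr => n _; congr (_ * (_ + _)).
by rewrite /mean /=; field.
Qed.

Lemma volRE K k i j : volR xi w g m U K k i j =
  (w j)^-1 * \sum_(n < N.+1) 2 * matQ xi w j n *
   (Fvol g (state U K i j) (state U K i n) k 0
      * mean (cov_eta K i j).1 (cov_eta K i n).1
    + Gvol g (state U K i j) (state U K i n) k 0
      * mean (cov_eta K i j).2 (cov_eta K i n).2).
Proof.
rewrite mxE; congr (_ * _); apply: eq_bigr => n _; congr (_ * (_ + _)).
by rewrite /mean /=; field.
Qed.

(** A split form of J b_x for [c = fst] and of J b_y for [c = snd]. It uses the same averaged metric
    terms as flux differencing, so that volume terms and source can be compared entry by entry. *)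
Definition bottom_slope (c : R * R -> R) K i j : R :=
  \sum_n D i n * (mean (c (cov_xi K i j)) (c (cov_xi K n j)) * b K n j)
  + \sum_n D j n * (mean (c (cov_eta K i j)) (c (cov_eta K i n)) * b K i n).

Definition bottom_jump (c : R * R -> R) K i j : R :=
  (w i)^-1 * (c (cov_xi K i j)
    * (xi_rows (avg_h m U b ext K) i j * xi_rows (jump_b m U b ext K) i j))
  + (w j)^-1 * (c (cov_eta K i j)
    * (eta_cols (avg_h m U b ext K) i j * eta_cols (jump_b m U b ext K) i j)).

Lemma mean_sum (d c e : 'I_N.+1 -> R) c0 :
  2 * \sum_n d n * (mean c0 (c n) * e n) =
  c0 * \sum_n d n * e n + \sum_n d n * (c n * e n).
Proof.
rewrite !mulr_sumr -big_split; apply: eq_bigr => n _.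
by rewrite /mean /=; field.
Qed.

Lemma split_form_bottom (ye yx : 'M[R]_N.+1) K i j :
  (ye ⊙ (D *m b K) + D *m (ye ⊙ b K) - yx ⊙ (b K *m D^T)
    - (yx ⊙ b K) *m D^T) i j =
  2 * (\sum_n D i n * (mean (ye i j) (ye n j) * b K n j)
       + \sum_n D j n * (mean (- yx i j) (- yx i n) * b K i n)).
Proof.
rewrite mulrDr !mean_sum mulNr -[X in _ = _ + (- _ + X)]opprK -sumrN.
have DT (A : 'M[R]_N.+1) : (A *m D^T) i j = \sum_n D j n * A i n.
  by rewrite mxE; apply: eq_bigr => n _; rewrite [D^T n j]mxE mulrC.
have DA (A : 'M[R]_N.+1) : (D *m A) i j = \sum_n D i n * A n j by rewrite mxE.
rewrite !(mxE_add, mxE_opp, mxE_hadamard, DT, DA) -!addrA;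
  congr (_ + (_ + (_ - _))).
- by apply: eq_bigr => n _; rewrite mxE_hadamard.
- by apply: eq_bigr => n _; rewrite mxE_hadamard mulNr mulrN opprK.
Qed.

Lemma source2E K i j : source2 xi w g m U b ext K i j =
  - g * U K k1 i j * bottom_slope fst K i j - g / 2 * bottom_jump fst K i j.
Proof.
rewrite /source2 /bottom_jump !(mxE_add, mxE_opp, mxE_scale) mxE_hadamard.
rewrite split_form_bottom matMinv_mulmx mulmx_matMinv !mxE_hadamard.
rewrite /bottom_slope /cov_xi /cov_eta /=.
set A := \sum_n _; set B := \sum_n _; set wi := (w i)^-1; set wj := (w j)^-1.
by field.
Qed.

Lemma source3E K i j : source3 xi w g m U b ext K i j =
  - g * U K k1 i j * bottom_slope snd K i j - g / 2 * bottom_jump snd K i j.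
Proof.
have -> : source3 xi w g m U b ext K i j =
   (g / 2) * (U K k1 i j * (x_eta xi m K ⊙ (D *m b K)
     + D *m (x_eta xi m K ⊙ b K) - x_xi xi m K ⊙ (b K *m D^T)
     - (x_xi xi m K ⊙ b K) *m D^T) i j)
   - g / 2 * bottom_jump snd K i j.
  rewrite /source3 /bottom_jump.
  rewrite !(mxE_add, mxE_opp, mxE_scale, mxE_hadamard) matMinv_mulmx
    mulmx_matMinv.
  rewrite !mxE_hadamard /cov_xi /cov_eta /=.
  set wi := (w i)^-1; set wj := (w j)^-1.
  by field.
rewrite split_form_bottom; congr (_ + _).
have -> : bottom_slope snd K i j =
  - (\sum_n D i n * (mean (x_eta xi m K i j) (x_eta xi m K n j) * b K n j)
     + \sum_n D j n * (mean (- x_xi xi m K i j) (- x_xi xi m K i n) * b K i n)).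
  rewrite /bottom_slope /cov_xi /cov_eta /= opprD -!sumrN; congr (_ + _);
    by apply: eq_bigr => n _; rewrite /mean; field.
by field.
Qed.

End ElementWeakForm.

(** * Balance on one element against an arbitrary test function *)

Section ElementBalance.
Context {R : realType} {N : nat}.
Variables (xi w : 'I_N.+1 -> R) (g : R).
Hypotheses (xi_inj : injective xi) (hSBP : SBP xi w) (hN : (0 < N)%N).
Hypothesis w_neq0 : forall i, w i != 0.
Variables (T : finType) (m : @mesh R T) (oF oG : @orientation N T).
Hypothesis hmetric : metric_identities xi m.
Variables (U : @nodal_data R N T) (b : T -> 'M[R]_N.+1).
Variable ext : @boundary_data R N T.
Local Notation D := (matD xi).
Local Notation cov_xi := (cov_xi xi m).
Local Notation cov_eta := (cov_eta xi m).
Local Notation st K i j := (state U K i j).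
Local Notation Fs := (Fstar g m oF U b ext).
Local Notation Gs := (Gstar g m oG U b ext).

Definition quad2 (X : 'I_N.+1 -> 'I_N.+1 -> R) : R :=
  \sum_i \sum_j w i * w j * X i j.

Lemma quad2l X : quad2 X = \sum_i w i * \sum_j w j * X i j.
Proof.
apply: eq_bigr => i _; rewrite mulr_sumr; apply: eq_bigr => j _.
by rewrite mulrA.
Qed.

Lemma quad2r X : quad2 X = \sum_j w j * \sum_i w i * X i j.
Proof.
rewrite /quad2 exchange_big; apply: eq_bigr => i _; rewrite mulr_sumr.
by apply: eq_bigr => j _; rewrite mulrCA mulrA.
Qed.

Lemma quad2D X Y : quad2 (fun i j => X i j + Y i j) = quad2 X + quad2 Y.
Proof.
rewrite -big_split; apply: eq_bigr => i _; rewrite -big_split.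
by apply: eq_bigr => j _; rewrite /= mulrDr.
Qed.

Lemma quad2Z c X : quad2 (fun i j => c * X i j) = c * quad2 X.
Proof.
rewrite mulr_sumr; apply: eq_bigr => i _; rewrite mulr_sumr.
by apply: eq_bigr => j _; rewrite mulrCA.
Qed.

Lemma eq_quad2 X Y : (forall i j, X i j = Y i j) -> quad2 X = quad2 Y.
Proof. by move=> e; apply: eq_bigr => i _; apply: eq_bigr => j _;
  rewrite e. Qed.

Lemma quad2_0 X : (forall i j, X i j = 0) -> quad2 X = 0.
Proof.
move=> e; apply: big1 => i _; apply: big1 => j _.
by rewrite e mulr0.
Qed.

Lemma ord_max_neq0 : (ord_max == ord0 :> 'I_N.+1) = false.
Proof. by apply/negbTE; rewrite -val_eqE /= -lt0n. Qed.

Lemma ord0_neq_max : (ord0 == ord_max :> 'I_N.+1) = false.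
Proof. by rewrite eq_sym ord_max_neq0. Qed.

Lemma xi_rowsE (p : side -> 'I_N.+1 -> R) i j : xi_rows p i j =
  (i == ord0)%:R * p west j + (i == ord_max)%:R * p east j.
Proof.
rewrite mxE; case: eqP => [->|_].
  by rewrite eq_sym ord_max_neq0 mul1r mul0r addr0.
by case: eqP => _; rewrite mul0r add0r ?mul1r ?mul0r.
Qed.

Lemma eta_colsE (p : side -> 'I_N.+1 -> R) i j : eta_cols p i j =
  (j == ord0)%:R * p south i + (j == ord_max)%:R * p north i.
Proof.
rewrite mxE; case: eqP => [->|_].
  by rewrite eq_sym ord_max_neq0 mul1r mul0r addr0.
by case: eqP => _; rewrite mul0r add0r ?mul1r ?mul0r.
Qed.

Lemma xi_rowsM (p q : side -> 'I_N.+1 -> R) i j :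
  xi_rows p i j * xi_rows q i j = xi_rows (fun s r => p s r * q s r) i j.
Proof. by rewrite !mxE; case: ifP => // _; case: ifP => // _;
  rewrite mulr0. Qed.

Lemma eta_colsM (p q : side -> 'I_N.+1 -> R) i j :
  eta_cols p i j * eta_cols q i j = eta_cols (fun s r => p s r * q s r) i j.
Proof. by rewrite !mxE; case: ifP => // _; case: ifP => // _;
  rewrite mulr0. Qed.

Lemma Fstar_tildeE K k i j : Fstar_tilde xi g m oF oG U b ext K k i j =
  (i == ord0)%:R * ((cov_xi K i j).1 * Fs K west j k 0
                    + (cov_xi K i j).2 * Gs K west j k 0)
  + (i == ord_max)%:R * ((cov_xi K i j).1 * Fs K east j k 0
                         + (cov_xi K i j).2 * Gs K east j k 0).
Proof.
have e (p p' : side -> 'I_N.+1 -> R) (A B : 'M[R]_N.+1) :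
    (A ⊙ xi_rows p - B ⊙ xi_rows p') i j =
    (i == ord0)%:R * (A i j * p west j + - B i j * p' west j)
    + (i == ord_max)%:R * (A i j * p east j + - B i j * p' east j).
  by rewrite mxE_add mxE_opp !mxE_hadamard !xi_rowsE; ring.
exact: e.
Qed.

Lemma Gstar_tildeE K k i j : Gstar_tilde xi g m oF oG U b ext K k i j =
  (j == ord0)%:R * ((cov_eta K i j).1 * Fs K south i k 0
                    + (cov_eta K i j).2 * Gs K south i k 0)
  + (j == ord_max)%:R * ((cov_eta K i j).1 * Fs K north i k 0
                         + (cov_eta K i j).2 * Gs K north i k 0).
Proof.
have e (p p' : side -> 'I_N.+1 -> R) (A B : 'M[R]_N.+1) :
    (- (A ⊙ eta_cols p) + B ⊙ eta_cols p') i j =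
    (j == ord0)%:R * (- A i j * p south i + B i j * p' south i)
    + (j == ord_max)%:R * (- A i j * p north i + B i j * p' north i).
  by rewrite mxE_add mxE_opp !mxE_hadamard !eta_colsE; ring.
exact: e.
Qed.

Lemma FtildeE K k i j : Ftilde xi g m U K k i j =
  (cov_xi K i j).1 * flux_f g (st K i j) k 0
  + (cov_xi K i j).2 * flux_g g (st K i j) k 0.
Proof. by rewrite [LHS]mxE mulNr. Qed.

Lemma GtildeE K k i j : Gtilde xi g m U K k i j =
  (cov_eta K i j).1 * flux_f g (st K i j) k 0
  + (cov_eta K i j).2 * flux_g g (st K i j) k 0.
Proof. by rewrite [LHS]mxE. Qed.

Lemma flux_defect_west K k r :
  (Fstar_tilde xi g m oF oG U b ext K k - Ftilde xi g m U K k) ord0 r =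
  (cov_xi K ord0 r).1 * (Fs K west r k 0 - flux_f g (st K ord0 r) k 0)
  + (cov_xi K ord0 r).2 * (Gs K west r k 0 - flux_g g (st K ord0 r) k 0).
Proof.
rewrite mxE_add mxE_opp Fstar_tildeE FtildeE eqxx [ord0 == ord_max]eq_sym
  ord_max_neq0.
by rewrite mul0r mul1r ?add0r ?addr0; ring.
Qed.

Lemma flux_defect_east K k r :
  (Fstar_tilde xi g m oF oG U b ext K k - Ftilde xi g m U K k) ord_max r =
  (cov_xi K ord_max r).1 * (Fs K east r k 0 - flux_f g (st K ord_max r) k 0)
  + (cov_xi K ord_max r).2 * (Gs K east r k 0 - flux_g g (st K ord_max r) k 0).
Proof.
rewrite mxE_add mxE_opp Fstar_tildeE FtildeE eqxx ord_max_neq0.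
by rewrite mul0r mul1r ?add0r ?addr0; ring.
Qed.

Lemma flux_defect_south K k r :
  (Gstar_tilde xi g m oF oG U b ext K k - Gtilde xi g m U K k) r ord0 =
  (cov_eta K r ord0).1 * (Fs K south r k 0 - flux_f g (st K r ord0) k 0)
  + (cov_eta K r ord0).2 * (Gs K south r k 0 - flux_g g (st K r ord0) k 0).
Proof.
rewrite mxE_add mxE_opp Gstar_tildeE GtildeE eqxx [ord0 == ord_max]eq_sym
  ord_max_neq0.
by rewrite mul0r mul1r ?add0r ?addr0; ring.
Qed.

Lemma flux_defect_north K k r :
  (Gstar_tilde xi g m oF oG U b ext K k - Gtilde xi g m U K k) r ord_max =
  (cov_eta K r ord_max).1 * (Fs K north r k 0 - flux_f g (st K r ord_max) k 0)
  + (cov_eta K r ord_max).2 * (Gs K north r k 0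
    - flux_g g (st K r ord_max) k 0).
Proof.
rewrite mxE_add mxE_opp Gstar_tildeE GtildeE eqxx ord_max_neq0.
by rewrite mul0r mul1r ?add0r ?addr0; ring.
Qed.

(** The inverse weight in the source cancels the quadrature weight across the side, so the
    tensor-product sum collapses to the quadrature along each side. *)
Lemma bottom_jump_weak (c : R * R -> R) (f : 'I_N.+1 -> 'I_N.+1 -> R) K :
  quad2 (fun i j => f i j * bottom_jump xi w m U b ext c K i j) =
  \sum_s \sum_r w r * (f (side_node s r).1 (side_node s r).2 *
    (c (conormal xi m K s r) * (avg_h m U b ext K s r
      * jump_b m U b ext K s r))).
Proof.
rewrite sum_side /bottom_jump.
under eq_quad2 do rewrite mulrDr.
rewrite quad2D -addrA; congr (_ + _).
  rewrite quad2r -big_split; apply: eq_bigr => j _ /=; rewrite -mulrDr.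
  congr (_ * _); rewrite -(sum_deltaM ord0 (fun i => f i j *
    (c (cov_xi K i j) * (avg_h m U b ext K west j
      * jump_b m U b ext K west j)))).
  rewrite -(sum_deltaM ord_max (fun i => f i j *
    (c (cov_xi K i j) * (avg_h m U b ext K east j
      * jump_b m U b ext K east j)))).
  rewrite -big_split; apply: eq_bigr => i _ /=; rewrite xi_rowsM xi_rowsE.
  by rewrite mulrCA mulVKf //; ring.
rewrite quad2l -big_split; apply: eq_bigr => i _ /=; rewrite -mulrDr.
congr (_ * _); rewrite -(sum_deltaM ord0 (fun j => f i j *
  (c (cov_eta K i j) * (avg_h m U b ext K south i
    * jump_b m U b ext K south i)))).
rewrite -(sum_deltaM ord_max (fun j => f i j *
  (c (cov_eta K i j) * (avg_h m U b ext K north i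
    * jump_b m U b ext K north i)))).
rewrite -big_split; apply: eq_bigr => j _ /=; rewrite eta_colsM eta_colsE.
by rewrite mulrCA mulVKf //; ring.
Qed.

Section Test.
Variables (K : T) (q : 'I_N.+1 -> 'I_N.+1 -> 'cV[R]_3).
Variables (pf pg sf sg : 'I_N.+1 -> 'I_N.+1 -> R) (gam : R).
Hypothesis hgt_neq0 : forall i j, hgt (st K i j) != 0.
Hypothesis hF : forall i j i' j',
  dot (q i' j' - q i j) (Fvol g (st K i j) (st K i' j')) =
  pf i' j' - pf i j + gam * (mean (sf i j) (sf i' j') * (b K i' j' - b K i j)).
Hypothesis hG : forall i j i' j',
  dot (q i' j' - q i j) (Gvol g (st K i j) (st K i' j')) =
  pg i' j' - pg i j + gam * (mean (sg i j) (sg i' j') * (b K i' j' - b K i j)).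

(** For the entropy variables and their potentials, this is the physical entropy flux in the
    direction [c]. *)
Let E (c : R * R) i j := c.1 * (dot (q i j) (flux_f g (st K i j)) - pf i j)
  + c.2 * (dot (q i j) (flux_g g (st K i j)) - pg i j).

(** The metric remainder of a grid line. It is linear in [c], so the contributions of the two
    directions can be added. *)
Let M (c : R * R) i j := (pf i j + gam * sf i j * b K i j / 2) * c.1
  + (pg i j + gam * sg i j * b K i j / 2) * c.2.

Lemma volP_weak :
  quad2 (fun i j => \sum_k q i j k 0 * volP xi w g m U K k i j) =
  \sum_j w j * (E (cov_xi K ord_max j) ord_max j - E (cov_xi K ord0 j) ord0 j)
  + quad2 (fun i j => M (\sum_n D i n * (cov_xi K n j).1,
                         \sum_n D i n * (cov_xi K n j).2) i j)
  - gam * quad2 (fun i j =>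
     sf i j * (\sum_n D i n * (mean (cov_xi K i j).1 (cov_xi K n j).1
       * b K n j))
     + sg i j * (\sum_n D i n * (mean (cov_xi K i j).2 (cov_xi K n j).2
       * b K n j))).
Proof.
rewrite !quad2r mulr_sumr -big_split -sumrB; apply: eq_bigr => j _ /=.
under eq_bigr do under eq_bigr do rewrite volPE.
rewrite (line_weak xi_inj hSBP w_neq0 (fun i => (cov_xi K i j).1)
  (fun i => (cov_xi K i j).2) (fun i => hgt_neq0 i j)
  (fun i n => hF i j n j) (fun i n => hG i j n j)).
by rewrite /E /M /=; ring.
Qed.

Lemma volR_weak :
  quad2 (fun i j => \sum_k q i j k 0 * volR xi w g m U K k i j) =
  \sum_i w i * (E (cov_eta K i ord_max) i ord_max - E (cov_eta K i ord0) i ord0)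
  + quad2 (fun i j => M (\sum_n D j n * (cov_eta K i n).1,
                         \sum_n D j n * (cov_eta K i n).2) i j)
  - gam * quad2 (fun i j =>
     sf i j * (\sum_n D j n * (mean (cov_eta K i j).1 (cov_eta K i n).1
       * b K i n))
     + sg i j * (\sum_n D j n * (mean (cov_eta K i j).2 (cov_eta K i n).2
       * b K i n))).
Proof.
rewrite !quad2l mulr_sumr -big_split -sumrB; apply: eq_bigr => i _ /=.
under eq_bigr do under eq_bigr do rewrite volRE.
rewrite (line_weak xi_inj hSBP w_neq0 (fun j => (cov_eta K i j).1)
  (fun j => (cov_eta K i j).2) (fun j => hgt_neq0 i j)
  (fun j n => hF i j i n) (fun j n => hG i j i n)).
by rewrite /E /M /=; ring.
Qed.

Lemma surfF_weak :
  quad2 (fun i j => \sum_k q i j k 0 *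
    (matS w *m (Fstar_tilde xi g m oF oG U b ext K k
      - Ftilde xi g m U K k)) i j) =
  \sum_j w j *
    ((cov_xi K ord0 j).1 * (dot (q ord0 j) (Fs K west j
      - flux_f g (st K ord0 j)))
     + (cov_xi K ord0 j).2 * (dot (q ord0 j) (Gs K west j
       - flux_g g (st K ord0 j)))
     - ((cov_xi K ord_max j).1
          * (dot (q ord_max j) (Fs K east j - flux_f g (st K ord_max j)))
        + (cov_xi K ord_max j).2
          * (dot (q ord_max j) (Gs K east j - flux_g g (st K ord_max j))))).
Proof.
rewrite quad2r; apply: eq_bigr => j _; congr (_ * _).
under eq_bigr do rewrite mulr_sumr.
rewrite exchange_big /=.
under eq_bigr => k _ do rewrite (matS_weak w_neq0 (fun i => q i j k 0)).
rewrite sumrB; congr (_ - _); rewrite /dot !mulr_sumr -big_split;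
  apply: eq_bigr => k _ /=.
  rewrite flux_defect_west [(Fs _ _ _ - _) k 0]mxE_add [(Gs _ _ _
    - _) k 0]mxE_add.
  by rewrite [(- flux_f _ _) k 0]mxE_opp [(- flux_g _ _) k 0]mxE_opp /=; ring.
rewrite flux_defect_east [(Fs _ _ _ - _) k 0]mxE_add [(Gs _ _ _
  - _) k 0]mxE_add.
by rewrite [(- flux_f _ _) k 0]mxE_opp [(- flux_g _ _) k 0]mxE_opp /=; ring.
Qed.

Lemma surfG_weak :
  quad2 (fun i j => \sum_k q i j k 0 *
    ((Gstar_tilde xi g m oF oG U b ext K k
      - Gtilde xi g m U K k) *m matS w) i j) =
  \sum_i w i *
    ((cov_eta K i ord0).1 * (dot (q i ord0) (Fs K south i
      - flux_f g (st K i ord0)))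
     + (cov_eta K i ord0).2 * (dot (q i ord0) (Gs K south i
       - flux_g g (st K i ord0)))
     - ((cov_eta K i ord_max).1
          * (dot (q i ord_max) (Fs K north i - flux_f g (st K i ord_max)))
        + (cov_eta K i ord_max).2
          * (dot (q i ord_max) (Gs K north i - flux_g g (st K i ord_max))))).
Proof.
rewrite quad2l; apply: eq_bigr => i _; congr (_ * _).
under eq_bigr do rewrite mulr_sumr.
rewrite exchange_big /=.
under eq_bigr => k _ do rewrite (weak_matS w_neq0 (fun j => q i j k 0)).
rewrite sumrB; congr (_ - _); rewrite /dot !mulr_sumr -big_split;
  apply: eq_bigr => k _ /=.
  rewrite flux_defect_south [(Fs _ _ _ - _) k 0]mxE_add [(Gs _ _ _
    - _) k 0]mxE_add.
  by rewrite [(- flux_f _ _) k 0]mxE_opp [(- flux_g _ _) k 0]mxE_opp /=; ring.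
rewrite flux_defect_north [(Fs _ _ _ - _) k 0]mxE_add [(Gs _ _ _
  - _) k 0]mxE_add.
by rewrite [(- flux_f _ _) k 0]mxE_opp [(- flux_g _ _) k 0]mxE_opp /=; ring.
Qed.

Variable Ut : @nodal_data R N T.
Hypothesis hES : ESDGSEM xi w g m oF oG U b ext Ut.

(** The physical fluxes in the end terms of the volume sums cancel against those in the surface
    terms; this is what remains. *)
Definition side_balance s r : R :=
  let: (i, j) := side_node s r in
  outward s ((conormal xi m K s r).1 * (pf i j - dot (q i j) (Fs K s r))
             + (conormal xi m K s r).2 * (pg i j - dot (q i j) (Gs K s r))).

(** The four weak forms are added with the source left unevaluated. For conservation it is zero; for
    entropy its volume part cancels the [bottom_slope] terms. *)
Lemma element_weak_form :
  quad2 (fun i j => \sum_k q i j k 0 * (jac xi m K i j * Ut K k i j)) =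
  \sum_s \sum_r w r * side_balance s r
  + quad2 (fun i j => \sum_k q i j k 0 * source xi w g m U b ext K k i j
       + gam * (sf i j * bottom_slope xi m b fst K i j
                + sg i j * bottom_slope xi m b snd K i j)).
Proof.
have -> : quad2 (fun i j => \sum_k q i j k 0 * (jac xi m K i j * Ut K k i j)) =
   - quad2 (fun i j => \sum_k q i j k 0 * volP xi w g m U K k i j)
   - quad2 (fun i j => \sum_k q i j k 0 * volR xi w g m U K k i j)
   + quad2 (fun i j => \sum_k q i j k 0 *
    (matS w *m (Fstar_tilde xi g m oF oG U b ext K k
      - Ftilde xi g m U K k)) i j)
   + quad2 (fun i j => \sum_k q i j k 0 *
    ((Gstar_tilde xi g m oF oG U b ext K k
      - Gtilde xi g m U K k) *m matS w) i j)
   + quad2 (fun i j => \sum_k q i j k 0 * source xi w g m U b ext K k i j).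
  rewrite -[- quad2 _]mulN1r -[- quad2 (fun i j => \sum_k q i j k 0
    * volR _ _ _ _ _ _ _ _ _)]mulN1r.
  rewrite -!quad2Z -!quad2D; apply: eq_quad2 => i j.
  rewrite !mulN1r -!sumrN -!big_split; apply: eq_bigr => k _ /=.
  have /matrixP/(_ i j) := hES K k.
  rewrite mxE_add [X in X + _ = _]mxE_add mxE_hadamard.
  rewrite [RHS]mxE_add [X in _ = X + _]mxE_add => e.
  by move/(canRL (addrK _))/(canRL (addrK _)): e => ->; ring.
rewrite volP_weak volR_weak surfF_weak surfG_weak [in RHS]quad2D.
set qS := quad2 (fun i j => \sum_k q i j k 0 * source _ _ _ _ _ _ _ _ _ _ _).
(* The metric identities make the differentiated coefficients of the two directions opposite, node
   by node. *)
have M0 : quad2 (fun i j => M (\sum_n D i n * (cov_xi K n j).1,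
                         \sum_n D i n * (cov_xi K n j).2) i j) =
   - quad2 (fun i j => M (\sum_n D j n * (cov_eta K i n).1,
                         \sum_n D j n * (cov_eta K i n).2) i j).
  apply/eqP; rewrite -addr_eq0 -quad2D; apply/eqP/quad2_0 => i j.
  have [/eqP + /eqP] := metric_cov hmetric K i j.
  by rewrite !addr_eq0 /M /= => /eqP-> /eqP->; ring.
rewrite M0; set MM := quad2 _; rewrite quad2Z.
have -> : quad2 (fun i j => sf i j * bottom_slope xi m b fst K i j
                + sg i j * bottom_slope xi m b snd K i j) =
  quad2 (fun i j =>
     sf i j * (\sum_n D i n * (mean (cov_xi K i j).1 (cov_xi K n j).1
       * b K n j))
     + sg i j * (\sum_n D i n * (mean (cov_xi K i j).2 (cov_xi K n j).2
       * b K n j)))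
  + quad2 (fun i j =>
     sf i j * (\sum_n D j n * (mean (cov_eta K i j).1 (cov_eta K i n).1
       * b K i n))
     + sg i j * (\sum_n D j n * (mean (cov_eta K i j).2 (cov_eta K i n).2
       * b K i n))).
  by rewrite -quad2D; apply: eq_quad2 => i j; rewrite /bottom_slope; ring.
set B1 := quad2 _; set B2 := quad2 _.
rewrite sum_side.
have -> : \sum_r w r * side_balance west r + \sum_r w r * side_balance east r =
   - \sum_j w j * (E (cov_xi K ord_max j) ord_max j
     - E (cov_xi K ord0 j) ord0 j)
   + \sum_j w j *
    ((cov_xi K ord0 j).1 * (dot (q ord0 j) (Fs K west j
      - flux_f g (st K ord0 j)))
     + (cov_xi K ord0 j).2 * (dot (q ord0 j) (Gs K west j
       - flux_g g (st K ord0 j)))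
     - ((cov_xi K ord_max j).1
          * (dot (q ord_max j) (Fs K east j - flux_f g (st K ord_max j)))
        + (cov_xi K ord_max j).2
          * (dot (q ord_max j) (Gs K east j - flux_g g (st K ord_max j))))).
  rewrite -sumrN -!big_split; apply: eq_bigr => j _ /=.
  by rewrite /side_balance /E /= /outward /= !dotBr; ring.
rewrite -[X in _ = X + _]addrA.
have -> : \sum_r w r * side_balance south r
  + \sum_r w r * side_balance north r =
   - \sum_i w i * (E (cov_eta K i ord_max) i ord_max
     - E (cov_eta K i ord0) i ord0)
   + \sum_i w i *
    ((cov_eta K i ord0).1 * (dot (q i ord0) (Fs K south i
      - flux_f g (st K i ord0)))
     + (cov_eta K i ord0).2 * (dot (q i ord0) (Gs K south i
       - flux_g g (st K i ord0)))
     - ((cov_eta K i ord_max).1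
          * (dot (q i ord_max) (Fs K north i - flux_f g (st K i ord_max)))
        + (cov_eta K i ord_max).2
          * (dot (q i ord_max) (Gs K north i - flux_g g (st K i ord_max))))).
  rewrite -sumrN -!big_split; apply: eq_bigr => j _ /=.
  by rewrite /side_balance /E /= /outward /= !dotBr; ring.
ring.
Qed.

End Test.
End ElementBalance.

(** * Time derivative of the nodal entropy *)

Section ChainRule.
Context {R : realType} {N : nat}.
Variables (g : R) (T : finType) (W : R -> @nodal_data R N T).
Variables (b : T -> 'M[R]_N.+1) (t : R).

Lemma entropy_chain_rule K i j :
  (forall k, derivable (fun s : R => W s K k i j) t 1) ->
  hgt (state (W t) K i j) != 0 ->
  e_t g W b t K i j =
  dot (entropy_vars g (state (W t) K i j, b K i j)) (\col_k W_t W t K k i j).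
Proof.
move=> dW; rewrite /hgt mxE => h0.
pose f k : R -> R := fun s => W s K k i j.
have df k : is_derive t (1 : R) (f k) (derive1 (f k) t).
  by rewrite derive1E; apply/derivableP/dW.
pose v : R -> R := fun s => (f k1 s)^-1.
have dv : is_derive t (1 : R) v (- (f k1 t) ^- 2 *: derive1 (f k1) t).
  apply: DeriveDef; first exact: derivableV h0 (dW k1).
  by rewrite (deriveV h0 (dW k1)) derive1E.
rewrite mxE dotE !col3E !mxE /hgt /vel_u /vel_v /mom_x /mom_y /hgt !mxE /=.
rewrite -!/(f _) -/(f k1 t) -/(f k2 t) -/(f k3 t).
(* Written as a polynomial in the conserved variables and the reciprocal height [v], the entropy can
   be differentiated by the product and power rules; [b] does not depend on time. *)
rewrite (_ : (fun s => entropy _ _) =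
  (1 / 2) *: (f k1 * ((f k2 * v) ^+ 2
                      + (f k3 * v) ^+ 2))
  + (1 / 2 * g) *: (f k1 ^+ 2) + (g * b K i j) *: f k1); last first.
  apply/funext => s.
  rewrite /v /entropy /vel_u /vel_v /mom_x /mom_y /hgt !mxE /f !fctE /=.
  by rewrite /GRing.scale /=; ring.
have dk k := is_deriveX 2 (is_deriveM (df k) dv).
have d1 := is_deriveZ (1 / 2) (is_deriveM (df k1) (is_deriveD (dk k2) (dk k3))).
have d2 := is_deriveZ (1 / 2 * g) (is_deriveX 2 (df k1)).
have d3 := is_deriveZ (g * b K i j) (df k1).
rewrite derive1E (@derive_val _ _ _ _ _ _ _ (is_deriveD (is_deriveD d1 d2) d3)).
rewrite /v.
rewrite /GRing.scale /= !fctE.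
by field.
Qed.

End ChainRule.

(** * Conservation *)

Section ConservationWellBalance.
Context {R : realType} {N : nat}.
Variables (xi w : 'I_N.+1 -> R) (g : R).
Hypotheses (xi_inj : injective xi) (hSBP : SBP xi w) (hN : (0 < N)%N).
Hypothesis w_neq0 : forall i, w i != 0.
Variables (T : finType) (m : @mesh R T) (oF oG : @orientation N T).
Hypothesis hmetric : metric_identities xi m.
Variables (U : @nodal_data R N T) (b : T -> 'M[R]_N.+1).
Variable ext : @boundary_data R N T.
Local Notation D := (matD xi).

Lemma forall_traces_inner (P : @trace R -> Prop) K s r :
  forall_traces m U b ext P -> P (inner U b K s r).
Proof. by case=> h _; rewrite /inner; case: side_node. Qed.

Lemma forall_traces_outer (P : @trace R -> Prop) K s r :
  forall_traces m U b ext P -> P (outer m U b ext K s r).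
Proof.
move=> h; rewrite /outer; case e: nbr => [[K' s']|].
  exact: forall_traces_inner.
by have [_] := h; apply.
Qed.

Lemma jump_bE K s r : jump_b m U b ext K s r =
  outward s ((outer m U b ext K s r).2 - (inner U b K s r).2).
Proof. by rewrite /jump_b /local_pair /outward; case: s.2 => //=;
  rewrite opprB. Qed.

Lemma flux_pairE (o : @orientation N T) K s r : flux_pair m U b ext o K s r =
  if s.2 == o K s r then (inner U b K s r, outer m U b ext K s r)
  else (outer m U b ext K s r, inner U b K s r).
Proof. by rewrite /flux_pair /local_pair; case: s.2; case: (o K s r). Qed.

(** Half of the split form differentiates a constant; the other half is that constant times the
    metric identity. *)
Lemma bottom_slope_const (e : T -> 'M[R]_N.+1) e0 K i j :
  (forall i j, e K i j = e0) ->
  bottom_slope xi m e fst K i j = 0 /\ bottom_slope xi m e snd K i j = 0.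
Proof.
move=> he; have [m1 m2] := metric_cov hmetric K i j.
have slope0 (c1 c2 : 'I_N.+1 -> R) :
   \sum_n D i n * c1 n + \sum_n D j n * c2 n = 0 ->
   \sum_n D i n * (mean (c1 i) (c1 n) * e0)
   + \sum_n D j n * (mean (c2 j) (c2 n) * e0) = 0.
  move=> h; apply: (@mulfI _ 2); first by rewrite pnatr_eq0.
  rewrite mulrDr !mean_sum mulr0.
  have z c : \sum_n D c n * e0 = 0 by rewrite -mulr_suml sum_matD // mul0r.
  rewrite !z !mulr0 !add0r.
  transitivity ((\sum_n D i n * c1 n + \sum_n D j n * c2 n) * e0).
    by rewrite mulrDl !mulr_suml; congr (_ + _); apply: eq_bigr => n _;
      rewrite mulrA.
  by rewrite h mul0r.
split; rewrite /bottom_slope.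
  rewrite -[RHS](slope0 _ _ m1).
  by congr (_ + _); apply: eq_bigr => n _; rewrite he.
rewrite -[RHS](slope0 _ _ m2).
by congr (_ + _); apply: eq_bigr => n _; rewrite he.
Qed.

Lemma bottom_slopeD (e e' : T -> 'M[R]_N.+1) c K i j :
  bottom_slope xi m (fun K => e K + e' K) c K i j =
  bottom_slope xi m e c K i j + bottom_slope xi m e' c K i j.
Proof.
rewrite /bottom_slope addrACA -!big_split.
by apply: eq_bigr => n _ /=; rewrite !mxE_add !mulrDr.
Qed.

Lemma source_component K k i j : source xi w g m U b ext K k i j =
  (k == k2)%:R * source2 xi w g m U b ext K i j
  + (k == k3)%:R * source3 xi w g m U b ext K i j.
Proof.
rewrite /source; case: (altP (k =P k1)) => [->|h1].
  by rewrite mxE !mul0r addr0.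
case: (altP (k =P k2)) => [->|h2]; first by rewrite mul1r mul0r addr0.
have -> : k = k3.
  by apply/val_inj; move: h1 h2; rewrite -!val_eqE; case: k => [[|[|[|]]]].
by rewrite eqxx mul0r mul1r add0r.
Qed.

Lemma source_constant_bottom K k i j : constant_bottom m U b ext ->
  source xi w g m U b ext K k i j = 0.
Proof.
case=> c hc; rewrite source_component // source2E source3E.
have [-> ->] : bottom_slope xi m b fst K i j = 0 /\
               bottom_slope xi m b snd K i j = 0.
  by apply: (bottom_slope_const (e0 := c)) => i' j'; have [+ _] := hc; apply.
have j0 s r : jump_b m U b ext K s r = 0.
  rewrite jump_bE (forall_traces_outer K s r hc) (forall_traces_inner K s r hc).
  by rewrite subrr /outward; case: s.2; rewrite ?oppr0.
have z (d : R * R -> R) : bottom_jump xi w m U b ext d K i j = 0.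
  by rewrite /bottom_jump !(xi_rowsE hN, eta_colsE hN) !j0; ring.
by rewrite !z; ring.
Qed.

Variable Ut : @nodal_data R N T.
Hypothesis hES : ESDGSEM xi w g m oF oG U b ext Ut.
Hypothesis hpos : positive_height m U b ext.

Lemma hgt_state_neq0 K i j : hgt (state U K i j) != 0.
Proof. by have [+ _] := hpos => /(_ K i j) /= /lt0r_neq0. Qed.

Lemma conservation k :
  (forall K i j, source xi w g m U b ext K k i j = 0) ->
  conserves xi w g m oF oG U b ext Ut k.
Proof.
move=> s0 K; pose q (i j : 'I_N.+1) : 'cV[R]_3 := \col_k' (k' == k)%:R.
pose z (i j : 'I_N.+1) : R := 0.
have hq i j i' j' V : dot (q i' j' - q i j) V =
   z i' j' - z i j + 0 * (mean (z i j) (z i' j') * (b K i' j' - b K i j)).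
  by rewrite mul0r addr0 [RHS]subrr dotBl subrr.
have qE i j (V : 'cV[R]_3) : dot (q i j) V = V k 0.
  rewrite /dot (bigD1 k) //= big1 ?addr0 => [|k' /negbTE kk'].
    by rewrite mxE eqxx mul1r.
  by rewrite mxE kk' mul0r.
have := element_weak_form xi_inj hSBP hN w_neq0 hmetric (@hgt_state_neq0 K)
  (fun i j i' j' => hq i j i' j' _) (fun i j i' j' => hq i j i' j' _) hES.
have sumq i j (f : 'I_3 -> R) : \sum_k' q i j k' 0 * f k' = f k.
  rewrite (bigD1 k) //= big1 ?addr0 => [|k' /negbTE kk'].
    by rewrite mxE eqxx mul1r.
  by rewrite mxE kk' mul0r.
rewrite [X in _ = _ + X]quad2_0 => [|i j]; last by rewrite sumq s0 mul0r addr0.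
rewrite addr0 (eq_quad2 _ (Y := fun i j => jac xi m K i j * Ut K k i j));
  last first.
  by move=> i j; rewrite sumq.
have -> : quad2 w (fun i j => jac xi m K i j * Ut K k i j) =
  \sum_(i < N.+1) \sum_(j < N.+1) w i * w j * jac xi m K i j * Ut K k i j.
  by apply: eq_bigr => i _; apply: eq_bigr => j _; rewrite mulrA.
move=> ->; rewrite sum_side -addrA; congr (_ + _).
  rewrite -big_split -sumrN; apply: eq_bigr => r _ /=.
  rewrite /side_balance /= /outward /= !qE /z.
  rewrite !(Fstar_tildeE _ _ hN) !eqxx.
  by rewrite (ord_max_neq0 hN) (ord0_neq_max hN) /=; ring.
rewrite -big_split -sumrN; apply: eq_bigr => r _ /=.
rewrite /side_balance /= /outward /= !qE /z.
rewrite !(Gstar_tildeE _ _ hN) !eqxx.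
by rewrite (ord_max_neq0 hN) (ord0_neq_max hN) /=; ring.
Qed.

End ConservationWellBalance.

(** * Lake at rest *)

Section WellBalance.
Context {R : realType} {N : nat}.
Variables (xi w : 'I_N.+1 -> R) (g : R).
Hypotheses (xi_inj : injective xi) (hSBP : SBP xi w) (hN : (0 < N)%N).
Hypothesis w_neq0 : forall i, w i != 0.
Variables (T : finType) (m : @mesh R T) (oF oG : @orientation N T).
Hypothesis hmetric : metric_identities xi m.
Variables (U : @nodal_data R N T) (b : T -> 'M[R]_N.+1).
Variable ext : @boundary_data R N T.
Variable Ut : @nodal_data R N T.
Hypothesis hES : ESDGSEM xi w g m oF oG U b ext Ut.
Hypothesis hpos : positive_height m U b ext.
Hypothesis hrest : lake_at_rest m U b ext.
Local Notation D := (matD xi).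
Local Notation st K i j := (state U K i j).
Local Notation cov_xi := (cov_xi xi m).
Local Notation cov_eta := (cov_eta xi m).

Lemma ord3P (k : 'I_3) : [\/ k = k1, k = k2 | k = k3].
Proof.
by case: k => [[|[|[|//]]] i]; [constructor 1|constructor 2|constructor 3];
  exact/val_inj.
Qed.

Lemma col3_k2 (x : R) k : col3 0 x 0 k 0 = (k == k2)%:R * x.
Proof.
by case: (ord3P k) => ->; rewrite col3E -?[_ == k2]/false ?eqxx ?mul0r ?mul1r.
Qed.

Lemma col3_k3 (x : R) k : col3 0 0 x k 0 = (k == k3)%:R * x.
Proof.
by case: (ord3P k) => ->; rewrite col3E -?[_ == k3]/false ?eqxx ?mul0r ?mul1r.
Qed.

Lemma rest_node K i j :
  [/\ vel_u (st K i j) = 0, vel_v (st K i j) = 0,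
      mom_x (st K i j) = 0 & mom_y (st K i j) = 0].
Proof.
have [c [+ _]] := hrest => /(_ K i j)[/= _ u0 v0].
have h := hgt_state_neq0 hpos K i j.
by rewrite u0 v0 mom_xE // mom_yE // u0 v0 !mulr0.
Qed.

(** The product form of the pressure lets the local height factor out of the flux-differencing sum,
    leaving a derivative that is linear in [h]. *)
Lemma Fvol_rest K i j i' j' k : Fvol g (st K i j) (st K i' j') k 0 =
  (k == k2)%:R * (g / 2 * U K k1 i j * U K k1 i' j').
Proof.
have [u0 v0 p0 q0] := rest_node K i j.
have [u0' v0' p0' q0'] := rest_node K i' j'.
rewrite /Fvol /avg u0 v0 p0 u0' v0' p0' meanxx !mul0r add0r col3_k2.
by rewrite /mean /hgt !mxE; congr (_ * _); field.
Qed.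

Lemma Gvol_rest K i j i' j' k : Gvol g (st K i j) (st K i' j') k 0 =
  (k == k3)%:R * (g / 2 * U K k1 i j * U K k1 i' j').
Proof.
have [u0 v0 p0 q0] := rest_node K i j.
have [u0' v0' p0' q0'] := rest_node K i' j'.
rewrite /Gvol /avg u0 v0 q0 u0' v0' q0' meanxx !mul0r add0r col3_k3.
by rewrite /mean /hgt !mxE; congr (_ * _); field.
Qed.

Lemma flux_f_rest K i j k : flux_f g (st K i j) k 0 =
  (k == k2)%:R * (g / 2 * U K k1 i j ^+ 2).
Proof.
have [u0 v0 p0 q0] := rest_node K i j.
rewrite -Fvol_consistent ?(hgt_state_neq0 hpos) // Fvol_rest.
by congr (_ * _); ring.
Qed.

Lemma flux_g_rest K i j k : flux_g g (st K i j) k 0 =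
  (k == k3)%:R * (g / 2 * U K k1 i j ^+ 2).
Proof.
have [u0 v0 p0 q0] := rest_node K i j.
rewrite -Gvol_consistent ?(hgt_state_neq0 hpos) // Gvol_rest.
by congr (_ * _); ring.
Qed.

Lemma hgt_inner K s r :
  hgt (inner U b K s r).1 = U K k1 (side_node s r).1 (side_node s r).2.
Proof. by rewrite /inner; case: side_node => i j; rewrite /hgt mxE. Qed.

(* At rest the numerical flux differs from the physical one by a pressure
   difference, which [h + b = const] turns into the source jump. *)
Lemma surface_flux_rest K s r k : let h := hgt (inner U b K s r).1 in
  Fstar g m oF U b ext K s r k 0 = (k == k2)%:R * (g / 2 * h ^+ 2
     - g / 2 * avg_h m U b ext K s r * outward s (jump_b m U b ext K s r)) /\
  Gstar g m oG U b ext K s r k 0 = (k == k3)%:R * (g / 2 * h ^+ 2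
     - g / 2 * avg_h m U b ext K s r * outward s (jump_b m U b ext K s r)).
Proof.
have [c hc] := hrest.
have [ei ui vi] := forall_traces_inner K s r hc.
have [eo uo vo] := forall_traces_outer K s r hc.
have jb : outward s (jump_b m U b ext K s r) =
   hgt (inner U b K s r).1 - hgt (outer m U b ext K s r).1.
  by rewrite jump_bE /outward; case: s.2; rewrite ?opprK; lra.
rewrite jb /= /Fstar /Gstar !flux_pairE /avg_h.
move: (inner _ _ _ _ _) (outer _ _ _ _ _ _ _) ei ui vi eo uo vo => i o ei ui vi
  eo uo vo.
(* At rest the surface flux is symmetric in its two traces, so both orders are treated together. *)
pose p (e : bool) := if e then (i, o) else (o, i).
have FGp e :
    Fes g (p e).1 (p e).2 = col3 0 (g / 4 * (hgt i.1 ^+ 2 + hgt o.1 ^+ 2)) 0 /\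
    Ges g (p e).1 (p e).2 = col3 0 0 (g / 4 * (hgt i.1 ^+ 2 + hgt o.1 ^+ 2)).
  rewrite /p; case: e; first by rewrite Fes_rest ?Ges_rest // ei eo.
  by rewrite Fes_rest ?Ges_rest ?ei ?eo // [_ ^+ 2 + _]addrC.
have [-> _] := FGp (s.2 == oF K s r); have [_ ->] := FGp (s.2 == oG K s r).
by rewrite col3_k2 col3_k3 /mean; split; congr (_ * _); field.
Qed.

(** The volume terms are g h times the split slope of h. That slope is linear and annihilates the
    constant h + b, so it is the opposite of the slope of b. *)
Lemma volume_rest K k i j :
  volP xi w g m U K k i j + volR xi w g m U K k i j =
  - g * U K k1 i j * ((k == k2)%:R * bottom_slope xi m b fst K i j
                       + (k == k3)%:R * bottom_slope xi m b snd K i j).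
Proof.
have [c hc] := hrest.
have : (forall i j, (U K k1 + b K) i j = c).
  move=> i' j'; have [+ _] := hc => /(_ K i' j')[/= + _ _].
  by rewrite /hgt mxE_add mxE.
case/(bottom_slope_const xi_inj hmetric (e := fun K => U K k1 + b K) i j).
rewrite !bottom_slopeD => /(canRL (addrK _)) s1 /(canRL (addrK _)) s2.
have line (x1 x2 h : 'I_N.+1 -> R) a f1 f2 :
   (w a)^-1 * (\sum_n 2 * matQ xi w a n *
      (f1 * (g / 2 * h a * h n) * mean (x1 a) (x1 n)
       + f2 * (g / 2 * h a * h n) * mean (x2 a) (x2 n))) =
   g * h a * (f1 * (\sum_n D a n * (mean (x1 a) (x1 n) * h n))
              + f2 * (\sum_n D a n * (mean (x2 a) (x2 n) * h n))).
  rewrite mulrDr !mulr_sumr -big_split; apply: eq_bigr => n _.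
  by rewrite /= matQE; field; rewrite w_neq0.
have := line (fun n => (cov_xi K n j).1) (fun n => (cov_xi K n j).2)
  (fun n => U K k1 n j) i (k == k2)%:R (k == k3)%:R.
under eq_bigr do rewrite -Fvol_rest -Gvol_rest.
rewrite -volPE => ->.
have := line (fun n => (cov_eta K i n).1) (fun n => (cov_eta K i n).2)
  (fun n => U K k1 i n) j (k == k2)%:R (k == k3)%:R.
under eq_bigr do rewrite -Fvol_rest -Gvol_rest.
rewrite -volRE => -> /=.
transitivity (g * U K k1 i j *
  ((k == k2)%:R * bottom_slope xi m (fun K => U K k1) fst K i j
   + (k == k3)%:R * bottom_slope xi m (fun K => U K k1) snd K i j)).
  by rewrite /bottom_slope; ring.
by rewrite s1 s2; ring.
Qed.

(** The right-hand side is the xi-part of the jump term in the source with the opposite sign. *)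
Lemma surfF_rest K k i j :
  (matS w *m (Fstar_tilde xi g m oF oG U b ext K k - Ftilde xi g m U K k)) i j
  = g / 2 * (w i)^-1 *
    (((k == k2)%:R * (cov_xi K i j).1 + (k == k3)%:R * (cov_xi K i j).2)
     * (xi_rows (avg_h m U b ext K) i j * xi_rows (jump_b m U b ext K) i j)).
Proof.
rewrite matS_mulmx xi_rowsM !(xi_rowsE hN) flux_defect_west //.
rewrite flux_defect_east //.
rewrite !flux_f_rest !flux_g_rest /=.
have [-> ->] := surface_flux_rest K west j k.
have [-> ->] := surface_flux_rest K east j k.
rewrite !hgt_inner /outward /=.
case: (eqVneq i ord0) => [->|_].
  by rewrite (ord0_neq_max hN) /=; field; rewrite ?w_neq0.
by case: (eqVneq i ord_max) => [->|_] /=; field; rewrite ?w_neq0.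
Qed.

Lemma surfG_rest K k i j :
  ((Gstar_tilde xi g m oF oG U b ext K k - Gtilde xi g m U K k) *m matS w) i j
  = g / 2 * (w j)^-1 *
    (((k == k2)%:R * (cov_eta K i j).1 + (k == k3)%:R * (cov_eta K i j).2)
     * (eta_cols (avg_h m U b ext K) i j * eta_cols (jump_b m U b ext K) i j)).
Proof.
rewrite mulmx_matS eta_colsM !(eta_colsE hN) flux_defect_south //.
rewrite flux_defect_north //.
rewrite !flux_f_rest !flux_g_rest /=.
have [-> ->] := surface_flux_rest K south i k.
have [-> ->] := surface_flux_rest K north i k.
rewrite !hgt_inner /outward /=.
case: (eqVneq j ord0) => [->|_].
  by rewrite (ord0_neq_max hN) /=; field; rewrite ?w_neq0.
by case: (eqVneq j ord_max) => [->|_] /=; field; rewrite ?w_neq0.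
Qed.

Lemma lake_at_rest_steady K k : (forall i j, jac xi m K i j != 0) -> Ut K k = 0.
Proof.
move=> J0; apply/matrixP => i j; rewrite [RHS]mxE; apply: (mulfI (J0 i j)).
rewrite mulr0; have /matrixP/(_ i j) := hES K k.
rewrite mxE_add [X in X + _ = _]mxE_add mxE_hadamard -addrA volume_rest.
rewrite [RHS]mxE_add [X in _ = X + _]mxE_add surfF_rest surfG_rest.
rewrite source_component source2E source3E /bottom_jump.
move/(canRL (addrK _)) => ->; ring.
Qed.

End WellBalance.

(** * Entropy stability *)

Section EntropyStability.
Context {R : realType} {N : nat}.
Variables (xi w : 'I_N.+1 -> R) (g : R).
Hypotheses (hN : (0 < N)%N) (hLGL : is_LGL xi w) (hSBP : SBP xi w).
Hypothesis g_gt0 : 0 < g.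
Hypothesis w_gt0 : forall i, 0 < w i.
Variables (T : finType) (m : @mesh R T) (oF oG : @orientation N T).
Hypothesis hm : is_mesh xi m.
Hypothesis hmetric : metric_identities xi m.
Hypothesis hor : cartesian_orientation xi m oF oG.
Variables (U : @nodal_data R N T) (b : T -> 'M[R]_N.+1).
Variable ext : @boundary_data R N T.
Hypothesis hpos : positive_height m U b ext.
Local Notation ncn K s r := (outward_conormal xi m K s r).
Local Notation inn := (inner U b).
Local Notation out := (outer m U b ext).
Local Notation prodF K s r := (side_production_F g (inn K s r) (out K s r)
  (Fstar g m oF U b ext K s r)).
Local Notation prodG K s r := (side_production_G g (inn K s r) (out K s r)
  (Gstar g m oG U b ext K s r)).
Local Notation outflow :=
  (entropy_outflow xi m oF oG U b ext (num_entropy_F g) (num_entropy_G g)).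

(* A cartesian orientation orders the two states along the x- and y-components
   of the outward normal. *)
Lemma flux_pair_outward K s r :
  (0 < (ncn K s r).1 -> flux_pair m U b ext oF K s r =
    (inn K s r, out K s r)) /\
  ((ncn K s r).1 < 0 -> flux_pair m U b ext oF K s r =
    (out K s r, inn K s r)) /\
  (0 < (ncn K s r).2 -> flux_pair m U b ext oG K s r =
    (inn K s r, out K s r)) /\
  ((ncn K s r).2 < 0 -> flux_pair m U b ext oG K s r = (out K s r, inn K s r)).
Proof.
have [h1 h2] := hor K s r; rewrite !flux_pairE /outward_conormal /outward /=.
move: h1 h2; case: s.2; case: (oF K s r); case: (oG K s r) => /= h1 h2;
  (do ! split) => // h; exfalso; lra.
Qed.

Lemma outflowE K s r : outflow K s r =
  (ncn K s r).1 * num_entropy_F g (flux_pair m U b ext oF K s r).1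
                                  (flux_pair m U b ext oF K s r).2
  + (ncn K s r).2 * num_entropy_G g (flux_pair m U b ext oG K s r).1
                                    (flux_pair m U b ext oG K s r).2.
Proof.
by rewrite /entropy_outflow /outward_conormal /outward; case: s.2 => //=; ring.
Qed.

Lemma inner_outer_nbr K s r K' s' : nbr m K s = Some (K', s') ->
  inn K' s' (match_node s s' r) = out K s r /\
  out K' s' (match_node s s' r) = inn K s r.
Proof.
move=> e; have [e' _ _] := mesh_nbr hm e.
by rewrite /outer e e' match_nodeK.
Qed.

(** Across an interface both the normal and the roles of inner and outer are reversed, so the two
    elements evaluate the flux at the same ordered pair. Where a normal component vanishes the
    orders may differ, but the term is zero. *)
Lemma outflow_nbr K s r K' s' : nbr m K s = Some (K', s') ->
  outflow K' s' (match_node s s' r) = - outflow K s r.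
Proof.
move=> e; rewrite !outflowE.
have [p1 [p2 [p3 p4]]] := flux_pair_outward K s r.
have [p1' [p2' [p3' p4']]] := flux_pair_outward K' s' (match_node s s' r).
move: p1' p2' p3' p4'.
have [-> ->] : (ncn K' s' (match_node s s' r)).1 = - (ncn K s r).1 /\
               (ncn K' s' (match_node s s' r)).2 = - (ncn K s r).2.
  by rewrite (outward_conormal_nbr hN hLGL hm r e).
rewrite !oppr_gt0 !oppr_lt0.
have [-> ->] := inner_outer_nbr r e => p1' p2' p3' p4'.
rewrite opprD; congr (_ + _); rewrite -mulNr.
  have [c0|c0|->] := ltgtP (ncn K s r).1 0; last by rewrite oppr0 !mul0r.
    by rewrite p2 // p1'.
  by rewrite p1 // p2'.
have [c0|c0|->] := ltgtP (ncn K s r).2 0; last by rewrite oppr0 !mul0r.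
  by rewrite p4 // p3'.
by rewrite p3 // p4'.
Qed.

Lemma sum_outflow_nbr K s K' s' : nbr m K s = Some (K', s') ->
  \sum_r w r * outflow K' s' r = - \sum_r w r * outflow K s r.
Proof.
move=> e; rewrite (reindex (match_node s s')); last first.
  by exists (match_node s' s) => r _; apply: match_nodeK.
rewrite -sumrN; apply: eq_bigr => r _.
rewrite (outflow_nbr r e) mulrN; congr (- (_ * _)).
by rewrite /match_node; case: ifP => // _; rewrite (LGL_weight_rev hLGL).
Qed.

(* Crossing an interface is an involution of the interior sides that reverses
   the sign of the outflow. *)
Lemma interior_outflow (A : {set T}) :
  \sum_(K in A) \sum_(s : side | ~~ exposed m A K s) \sum_r w r
    * outflow K s r = 0.
Proof.
(* The default of [odflt] fixes the sides on the domain boundary, which makes [tau] an involution on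
   all pairs. *)
pose tau (p : T * side) := odflt p (nbr m p.1 p.2).
have tauK : involutive tau.
  move=> [K s]; rewrite /tau /=; case e : (nbr m K s) => [[K' s']|] /=.
    by have [-> _ _] := mesh_nbr hm e.
  by rewrite e.
pose P (p : T * side) := (p.1 \in A) && ~~ exposed m A p.1 p.2.
pose phi (p : T * side) := \sum_r w r * outflow p.1 p.2 r.
have PE p : P p -> exists2 p', nbr m p.1 p.2 = Some p' & p'.1 \in A.
  rewrite /P /exposed; case: (nbr m p.1 p.2) => [[K' s']|];
    last by rewrite andbF.
  by rewrite negbK => /andP[_ h]; exists (K', s').
have Ptau p : P (tau p) = P p.
  rewrite /P /exposed /tau; case: p => K s /=.
  case e : (nbr m K s) => [[K' s']|] /=; last by rewrite e.
  by have [-> _ _] := mesh_nbr hm e; rewrite !negbK andbC.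
rewrite pair_big_dep /= (eq_bigl P) //.
rewrite (eq_bigr phi) //.
(* Showing that the sum is its own opposite also covers a side glued to itself. *)
suff : \sum_(p | P p) phi p = - \sum_(p | P p) phi p by lra.
rewrite {1}(reindex_inj (inv_inj tauK)) -sumrN (eq_bigl P) //.
apply: eq_bigr => -[K s] /PE[[K' s'] e _].
by rewrite /phi /tau e /= (sum_outflow_nbr e).
Qed.

(** Restoring the interior sides, which contribute zero in total, reduces the inequality on a union
    of elements to one element at a time. *)
Lemma exposed_outflow (A : {set T}) :
  \sum_(K in A) \sum_(s : side | exposed m A K s) \sum_r w r * outflow K s r =
  \sum_(K in A) \sum_s \sum_r w r * outflow K s r.
Proof.
rewrite -[LHS]addr0 -[X in _ + X = _](interior_outflow A) -big_split.
apply: eq_bigr => K _ /=.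
by rewrite [RHS](bigID (exposed m A K)).
Qed.

(** The sign of each normal component decides which trace comes first, and with it which of the two
    inequalities of [side_production_F_le0] or [side_production_G_le0] applies. *)
Lemma side_entropy_le0 K s r :
  (ncn K s r).1 * prodF K s r
  + (ncn K s r).2 * prodG K s r
  + outflow K s r <= 0.
Proof.
have hi := forall_traces_inner K s r hpos.
have ho := forall_traces_outer K s r hpos.
have [p1 [p2 [p3 p4]]] := flux_pair_outward K s r.
rewrite outflowE addrACA -!mulrDr /Fstar /Gstar -[0]addr0 lerD //.
  have [c0|c0|->] := ltgtP (ncn K s r).1 0; last by rewrite mul0r.
    rewrite p2 //= nmulr_rle0 //.
    by have [] := side_production_F_le0 g_gt0 ho hi.
  rewrite p1 //= pmulr_rle0 //.
  by have [] := side_production_F_le0 g_gt0 hi ho.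
have [c0|c0|->] := ltgtP (ncn K s r).2 0; last by rewrite mul0r.
  rewrite p4 //= nmulr_rle0 //.
  by have [] := side_production_G_le0 g_gt0 ho hi.
rewrite p3 //= pmulr_rle0 //.
by have [] := side_production_G_le0 g_gt0 hi ho.
Qed.

Variable Ut : @nodal_data R N T.
Hypothesis hES : ESDGSEM xi w g m oF oG U b ext Ut.

(** Tested with u and v, the volume source gives -g hu and -g hv times the slopes of b, which cancel
    the slope terms of the weak form. The jump part of the source moves to the sides and completes
    the side production. *)
Lemma element_entropy_balance K :
  quad2 w (fun i j => jac xi m K i j *
     dot (entropy_vars g (state U K i j, b K i j)) (\col_k Ut K k i j)) =
  \sum_s \sum_r w r *
    ((ncn K s r).1 * prodF K s r
     + (ncn K s r).2 * prodG K s r).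
Proof.
have w0 i : w i != 0 by apply: lt0r_neq0.
have xi_inj := LGL_inj hLGL.
pose st i j := state U K i j.
pose z i j : @trace R := (st i j, b K i j).
pose q i j := entropy_vars g (z i j).
have h0 := hgt_state_neq0 hpos.
have := element_weak_form xi_inj hSBP hN w0 hmetric (h0 K)
  (fun i j i' j' => Fvol_entropy g (z := z i j) (z' := z i' j')
     (h0 K i j) (h0 K i' j'))
  (fun i j i' j' => Gvol_entropy g (z := z i j) (z' := z i' j')
     (h0 K i j) (h0 K i' j')) hES.
rewrite (eq_quad2 _ (Y := fun i j => jac xi m K i j *
     dot (q i j) (\col_k Ut K k i j))); last first.
  move=> i j; rewrite mulr_sumr; apply: eq_bigr => k _.
  by rewrite mxE; ring.
move=> ->.
rewrite (eq_quad2 _ (Y := fun i j => (- (g / 2)) *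
   (vel_u (st i j) * bottom_jump xi w m U b ext fst K i j)
   + (- (g / 2)) * (vel_v (st i j) * bottom_jump xi w m U b ext snd K i j)));
     last first.
  move=> i j; rewrite sum3 !source_component !col3E source2E source3E.
  rewrite -/(st i j) /= mom_xE ?mom_yE //; try exact: h0.
  have -> : U K k1 i j = hgt (st i j) by rewrite /hgt mxE.
  by rewrite /=; ring.
rewrite quad2D !quad2Z !bottom_jump_weak //.
rewrite !mulr_sumr -!big_split; apply: eq_bigr => s _ /=.
rewrite !mulr_sumr -!big_split; apply: eq_bigr => r _ /=.
rewrite !jump_bE /side_balance /side_production_F /side_production_G.
rewrite /avg_h /avg /outward_conormal /inner /q.
case: (side_node s r) => i j /=; rewrite /z /outward -/(st i j).
case: s.2 => /=; ring.
Qed.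

End EntropyStability.

Theorem theorem2 (R : realType) (N : nat) (hN : (0 < N)%N)
  (xi w : 'I_N.+1 -> R) (hLGL : is_LGL xi w) (hSBP : SBP xi w)
  (g : R) (hg : 0 < g)
  (T : finType) (m : @mesh R T) (hm : is_mesh xi m)
  (hmetric : metric_identities xi m)
  (oF oG : @orientation N T) :
  [/\ (* conservation of mass, and of momentum over a constant bottom *)
      forall (W : R -> nodal_data T) (b : T -> 'M[R]_N.+1)
             (ext : R -> boundary_data T) (t : R),
        solves_ESDGSEM xi w g m oF oG W b ext t ->
        conserves xi w g m oF oG (W t) b (ext t) (W_t W t) k1 /\
        (constant_bottom m (W t) b (ext t) ->
         conserves xi w g m oF oG (W t) b (ext t) (W_t W t) k2 /\
         conserves xi w g m oF oG (W t) b (ext t) (W_t W t) k3),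
      (* entropy stability *)
      cartesian_orientation xi m oF oG ->
      exists HF HG : @trace R -> @trace R -> R,
        consistent_entropy_fluxes g HF HG /\
        forall (W : R -> nodal_data T) (b : T -> 'M[R]_N.+1)
               (ext : R -> boundary_data T) (t : R),
          solves_ESDGSEM xi w g m oF oG W b ext t ->
          forall A : {set T},
            entropy_inequality xi w m oF oG (W t) b (ext t) HF HG
              (e_t g W b t) A
    & (* well-balancedness *)
      forall (W : R -> nodal_data T) (b : T -> 'M[R]_N.+1)
             (ext : R -> boundary_data T) (t : R),
        solves_ESDGSEM xi w g m oF oG W b ext t ->
        lake_at_rest m (W t) b (ext t) ->
        forall K k, W_t W t K k = 0].
Proof.
have w_gt0 i : 0 < w i.
  exact: LGL_weight_gt0 (LGL_inj hLGL) hSBP (LGL_first hLGL) (LGL_last hLGL)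
    (LGL_incr hLGL) i hN.
have w0 i : w i != 0 by apply: lt0r_neq0.
have xi_inj := LGL_inj hLGL.
split.
- move=> W b ext t [dW hpos hES].
  have cons := conservation xi_inj hSBP hN w0 hmetric hES hpos.
  split; first by apply: cons => K i j; rewrite source_component !mul0r addr0.
  move=> hb; split; apply: cons => K i j;
    exact: (source_constant_bottom w g xi_inj hN hmetric _ _ _ _ hb).
- move=> hor; exists (num_entropy_F g), (num_entropy_G g).
  split; first exact: num_entropy_consistent.
  move=> W b ext t [dW hpos hES] A; rewrite /entropy_inequality.
  rewrite (exposed_outflow g hN hLGL hSBP hm hor) -big_split.
  apply: sumr_le0 => K _ /=.
  rewrite [X in X + _](_ : _ = quad2 w (fun i j => jac xi m K i j *
     dot (entropy_vars g (state (W t) K i j, b K i j))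
         (\col_k W_t W t K k i j))).
    rewrite (element_entropy_balance hN hLGL hSBP w_gt0 hmetric hpos hES).
    rewrite -big_split; apply: sumr_le0 => s _ /=.
    rewrite -big_split; apply: sumr_le0 => r _ /=; rewrite -mulrDr.
    rewrite pmulr_rle0 //; exact: side_entropy_le0.
  apply: eq_bigr => i _; apply: eq_bigr => j _.
  rewrite entropy_chain_rule ?mulrA //; exact: hgt_state_neq0 hpos _ _ _.
- move=> W b ext t [dW hpos hES] hrest K k.
  have J0 i j : jac xi m K i j != 0 by rewrite lt0r_neq0 // (mesh_jac hm).
  exact: (lake_at_rest_steady xi_inj hN w0 hmetric hES hpos hrest k J0).
Qed.
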